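(* Let $K$ be a field. There is an algorithm which, given an $m\times n$ bigraded matrix $[\gamma]$ representing a morphism $\gamma:F\to F'$ of finitely generated free bipersistence modules with respect to ordered bases $B$ of $F$ and $B'$ of $F'$, computes a minimal Gröbner basis of $\operatorname{im}\gamma$ with respect to the ordered basis $B'$ in $O(mn\cdot\min(m,n)+n^2)$ time and $O(mn\cdot\min(m,n))$ memory.
   Context: A bipersistence module is a $K[x_1,x_2]$-module $M$ with a vector space decomposition $M=\bigoplus_{\mathbf z\in\mathbb Z^2}M_{\mathbf z}$ such that $x_iM_{\mathbf z}\subset M_{\mathbf z+\mathbf e_i}$. Morphisms are module homomorphisms preserving grades. $\mathbb Z^2$ carries the product partial order. A bipersistence module is free if it is isomorphic to a direct sum of modules $Q^{\mathbf g}$, $\mathbf g\in\mathbb Z^2$, where $Q^{\mathbf g}_{\mathbf z}=K$ if $\mathbf g\le\mathbf z$ and $0$ otherwise, with identity maps between the copies of $K$. A basis of a free module is a minimal homogeneous generating set. For a homogeneous element $b$, $\mathrm{gr}(b)$ is its grade. Given an ordered basis $B$ of a finitely generated free module $F$ and $v\in F_{\mathbf z}$, $[v]^B\in K^{|B|}$ is the unique vector with $[v]^B_i=0$ if $\mathrm{gr}(B_i)\not\le\mathbf z$ and $v=\sum_{i:\mathrm{gr}(B_i)\le \mathbf z}[v]^B_i x^{\mathbf z-\mathrm{gr}(B_i)}B_i$. A morphism $\gamma:F\to F'$ with ordered bases $B,B'$ is represented by the matrix over $K$ whose $j$-th column is $[\gamma(B_j)]^{B'}$ and is labeled by $\mathrm{gr}(B_j)$.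 A bigraded matrix is a matrix over $K$ with each column labeled by an element of $\mathbb Z^2$, the labels appearing in colexicographical order. Gröbner bases: the pivot of a nonzero vector $v$ is $\max\{i: v_i\neq0\}$. For a free module $F'$ with ordered basis $B'$ and nonzero $u\in F'_{\mathbf z}$ such that $[u]^{B'}$ has pivot $i$, the leading term is $\mathrm{LT}(u)=[u]^{B'}_i x^{\mathbf z-\mathrm{gr}(B'_i)}B'_i$. For a homogeneous submodule $N\subset F'$, $\mathrm L(N)$ is the submodule generated by the leading terms of the nonzero homogeneous elements of $N$. A set $G$ of homogeneous generators of $N$ is a Gröbner basis of $N$ if $\mathrm L(N)=\langle \mathrm{LT}(g): g\in G\rangle$; it is minimal if no proper subset of $G$ is a Gröbner basis of $N$. The output is a list of pairs $(v,\mathbf z)\in K^m\times\mathbb Z^2$, the pair standing for the element of $F'_{\mathbf z}$ with coordinate vector $v$. Cost model: an elementary arithmetic operation in $K$ takes $O(1)$ time and storing an element of $K$ takes $O(1)$ memory (and likewise for labels in $\mathbb Z^2$). *)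

(* Defs.v *)
From HB Require Import structures.
From mathcomp Require Import all_boot all_order all_algebra.
From mathcomp.multinomials Require Import freeg mpoly.

Set Implicit Arguments.
Unset Strict Implicit.
Unset Printing Implicit Defensive.

Import Order.TTheory GRing.Theory Num.Theory.
Local Open Scope ring_scope.

Definition grade : Type := (int * int)%type.

Definition legr (z w : grade) : bool := (z.1 <= w.1) && (z.2 <= w.2).

(* Colexicographic order: the second coordinate is compared first. *)
Definition colex (z w : grade) : bool :=
  (z.2 < w.2) || ((z.2 == w.2) && (z.1 <= w.1)).

Definition colex_sorted (n : nat) (lab : 'I_n -> grade) : Prop :=
  forall j k : 'I_n, (j <= k)%N -> colex (lab j) (lab k).

Definition unit_grade (i : 'I_2) : grade := if i == ord0 then (1, 0) else (0, 1).

Section Monomials.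
Variable K : fieldType.

(* The term c x^d; only used for grades d >= (0,0), where the absolute values
   are the coordinates of d. *)
Definition term (c : K) (d : grade) : {mpoly K[2]} :=
  c%:MP * ('X_(ord0 : 'I_2) ^+ absz d.1 * 'X_(ord_max : 'I_2) ^+ absz d.2).

End Monomials.

(* [@hpart K M z v] reads "v lies in M_z".  The last two axioms say that the
   module is the internal direct sum of the subspaces M_z, z in Z^2. *)
Record bipersMod (K : fieldType) : Type := BipersMod {
  carrier :> lmodType {mpoly K[2]};
  hpart : grade -> carrier -> Prop;
  hpart0 : forall z, hpart z 0;
  hpart_lin : forall z (c : K) u v,
    hpart z u -> hpart z v -> hpart z (c%:MP *: u + v);
  hpartX : forall (i : 'I_2) z v, hpart z v -> hpart (z + unit_grade i) ('X_i *: v);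
  hpart_span : forall v, exists l : seq (grade * carrier),
    (forall p, p \in l -> hpart p.1 p.2) /\ v = \sum_(p <- l) p.2;
  hpart_indep : forall (s : seq grade) (f : grade -> carrier),
    uniq s -> (forall z, hpart z (f z)) -> \sum_(z <- s) f z = 0 ->
    forall z, z \in s -> f z = 0 }.

Definition graded (K : fieldType) (M N : bipersMod K) (f : M -> N) : Prop :=
  forall z v, hpart z v -> hpart z (f v).

Definition isomorphic (K : fieldType) (M N : bipersMod K) : Prop :=
  exists (f : {linear M -> N}) (g : {linear N -> M}),
    [/\ graded f, graded g, cancel f g & cancel g f].

Section FreeModule.
Variables (K : fieldType) (I : choiceType) (g : I -> grade).

(* Q^h is K[x_1,x_2] with grades shifted by h: the element c of the copy of K
   at z >= h is the term c x^(z - h), so that x^(w - z) acts from Q^h_z to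
   Q^h_w as the identity of K. *)
Definition Qcomp (h z : grade) (p : {mpoly K[2]}) : Prop :=
  if legr h z then exists c : K, p = term c (z - h) else p = 0.

(* The direct sum of the modules Q^(g i), i : I, as finitely supported families
   of polynomials; the grade z part is formed componentwise. *)
Definition dsumQ_comp (z : grade) (f : {freeg I / {mpoly K[2]}}) : Prop :=
  forall i, Qcomp (g i) z (freeg.coeff i f).

Lemma Qcomp0 h z : Qcomp h z 0.
Proof.
rewrite /Qcomp; case: ifP => // _; exists 0.
by rewrite /term mpolyC0 mul0r.
Qed.

Lemma Qcomp_lin h z c p q :
  Qcomp h z p -> Qcomp h z q -> Qcomp h z (c%:MP * p + q).
Proof.
rewrite /Qcomp; case: ifP => [_ [a ->] [b ->]|_ -> ->]; last first.
  by rewrite mulr0 addr0.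
by exists (c * a + b); rewrite /term mulrA -mpolyCM -mulrDl -mpolyCD.
Qed.

Lemma legr_unit h z i : legr h z -> legr h (z + unit_grade i).
Proof.
rewrite /legr /unit_grade; case/andP => h1 h2.
by case: (i == ord0) => /=; rewrite ?addr0 ?h1 ?h2 ?andbT //= ler_wpDr.
Qed.

Lemma absz_addr1 (a : int) : 0 <= a -> absz (a + 1) = (absz a).+1.
Proof. by case: a => // a _; rewrite -PoszD addn1. Qed.

Lemma termX (i : 'I_2) (c : K) (d : grade) : legr 0 d ->
  'X_i * term c d = term c (d + unit_grade i).
Proof.
case/andP => /= d1 d2; rewrite /term /unit_grade mulrCA; congr (_ * _).
case: eqP => [->|/eqP ni] /=; rewrite !addr0 absz_addr1 // exprS.
  by rewrite !mulrA.
have -> : i = ord_max by case: i ni => -[|[|[]]] // ? _; apply: val_inj.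
by rewrite mulrCA.
Qed.

Lemma legr_sub h z : legr h z -> legr 0 (z - h).
Proof. by rewrite /legr /= !subr_ge0. Qed.

Lemma QcompX i h z p : Qcomp h z p -> Qcomp h (z + unit_grade i) ('X_i * p).
Proof.
rewrite /Qcomp; case: ifP => [hz [c ->]|_ ->]; last first.
  by rewrite mulr0; apply: Qcomp0.
rewrite legr_unit //; exists c; rewrite termX ?legr_sub //.
by rewrite addrAC.
Qed.

Lemma termE (c : K) (d : grade) :
  term c d = c *: 'X_[[multinom (if i == ord0 then absz d.1 else absz d.2) | i < 2]].
Proof.
rewrite /term mul_mpolyC; congr (_ *: _).
rewrite !mpolyXn -mpolyXD; congr mpolyX; apply/mnmP => i.
rewrite mnmE mnmDE !mulmnE !mnm1E.
by case: i => -[|[|[]]] // ?; rewrite /= ?muln1 ?muln0 ?addn0 ?mul1n ?mul0n.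
Qed.

Lemma Qcomp_span h (p : {mpoly K[2]}) : exists l : seq (grade * {mpoly K[2]}),
  (forall q, q \in l -> Qcomp h q.1 q.2) /\ p = \sum_(q <- l) q.2.
Proof.
pose d (m : 'X_{1..2}) : grade := ((m ord0 : nat)%:Z, (m ord_max : nat)%:Z).
exists [seq (h + d m, p@_m *: 'X_[m]) | m <- msupp p]; split; last first.
  by rewrite big_map -mpolyE.
move=> q /mapP [m _ ->] /=; rewrite /Qcomp /legr /= !lerDl !le0z_nat /=.
exists p@_m; rewrite termE; congr (_ *: mpolyX _ _); apply/mnmP => i.
rewrite mnmE /= !(addrC h.1, addrC h.2) !addrK.
by case: i => -[|[|[]]] //= hi; congr (m _); apply: val_inj.
Qed.

Lemma dsumQ_span (f : {freeg I / {mpoly K[2]}}) :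
  exists l : seq (grade * {freeg I / {mpoly K[2]}}),
  (forall q, q \in l -> dsumQ_comp q.1 q.2) /\ f = \sum_(q <- l) q.2.
Proof.
suff [l [hl Ef]] : exists l : seq (grade * {freeg I / {mpoly K[2]}}),
    (forall q, q \in l -> dsumQ_comp q.1 q.2) /\
    \sum_(i <- dom f) << freeg.coeff i f *g i >> = \sum_(q <- l) q.2.
  by exists l; split=> //; rewrite -Ef freeg_sumE.
elim: (dom f) => [|i s [l [hl IH]]]; first by exists [::]; rewrite !big_nil.
have [li [hli Ei]] := Qcomp_span (g i) (freeg.coeff i f).
exists ([seq (q.1, << q.2 *g i >>) | q <- li] ++ l); split.
  move=> q; rewrite mem_cat => /orP[/mapP[r rl ->] k|]; last exact: hl.
  rewrite coeffU; case: eqP => [<-|_]; last by rewrite mulr0; apply: Qcomp0.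
  by rewrite mulr1; apply: hli.
rewrite big_cons big_cat /= big_map -IH; congr (_ + _).
rewrite {1}Ei; apply/eqP/freeg_eqP => k; rewrite coeffU raddf_sum /= mulr_suml.
by apply: eq_bigr => q _; rewrite coeffU.
Qed.

Lemma dsumQ_indep (s : seq grade) (f : grade -> {freeg I / {mpoly K[2]}}) :
  uniq s -> (forall z, dsumQ_comp z (f z)) -> \sum_(z <- s) f z = 0 ->
  forall z, z \in s -> f z = 0.
Proof.
move=> us hf sum0 z zs; apply/eqP/freeg_eqP => i; rewrite coeff0.
have := hf z i; rewrite /Qcomp; case: ifP => // le_z [c Ec].
pose mon (d : grade) : 'X_{1..2} :=
  [multinom (if k == ord0 then absz d.1 else absz d.2) | k < 2].
have := congr1 (fun u => (freeg.coeff i u)@_(mon (z - g i))) sum0.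
rewrite coeff0 mcoeff0 raddf_sum /= raddf_sum /= (bigD1_seq z) //=.
rewrite big1 ?addr0 => [|w nwz].
  by rewrite Ec termE mcoeffZ mcoeffX eqxx mulr1 => ->; rewrite scale0r.
have := hf w i; rewrite /Qcomp; case: ifP => [le_w [b ->]|_ ->]; last first.
  by rewrite mcoeff0.
rewrite termE mcoeffZ mcoeffX; case: eqP => [/mnmP E|_]; last by rewrite mulr0.
have {E} [E1 E2] := (E ord0, E ord_max); rewrite !mnmE /= in E1 E2.
case/negP: nwz; apply/eqP; apply: (addIr (- g i)).
have /andP[/= w1 w2] := legr_sub le_w; have /andP[/= z1 z2] := legr_sub le_z.
rewrite [LHS]surjective_pairing [RHS]surjective_pairing /=.
by rewrite -(gez0_abs w1) -(gez0_abs w2) E1 E2 !gez0_abs.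
Qed.

Definition dsumQ : bipersMod K.
Proof.
refine (@BipersMod K {freeg I / {mpoly K[2]}} dsumQ_comp _ _ _
          dsumQ_span dsumQ_indep).
- by move=> z i; rewrite coeff0; apply: Qcomp0.
- by move=> z c u v hu hv i; rewrite coeffD coeffZ; apply: Qcomp_lin.
- by move=> i z v hv k; rewrite coeffZ; apply: QcompX.
Defined.

End FreeModule.

Definition is_free (K : fieldType) (M : bipersMod K) : Prop :=
  exists (I : choiceType) (g : I -> grade), isomorphic M (dsumQ K g).

Section Bases.
Variables (K : fieldType) (M : bipersMod K).

Definition homogeneous (v : M) : Prop := exists z, hpart z v.

Definition gen (S : M -> Prop) (v : M) : Prop :=
  exists l : seq ({mpoly K[2]} * M),
    (forall p, p \in l -> S p.2) /\ v = \sum_(p <- l) p.1 *: p.2.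

Definition hom_generates (S N : M -> Prop) : Prop :=
  (forall b, S b -> homogeneous b) /\ (forall v, gen S v <-> N v).

Definition is_basis (S : M -> Prop) : Prop :=
  hom_generates S (fun=> True) /\
  forall S' : M -> Prop, (forall b, S' b -> S b) ->
    hom_generates S' (fun=> True) -> forall b, S b -> S' b.

(* [gr] lists the grades of the basis elements; these are nonzero, by
   minimality, so that their grades are unique. *)
Definition ordered_basis (k : nat) (B : 'I_k -> M) (gr : 'I_k -> grade) : Prop :=
  [/\ injective B, is_basis (fun b => exists i, B i = b)
    & forall i, hpart (gr i) (B i)].

(* [coords B gr z v c] reads "c = [v]^B" for v in M_z. *)
Definition coords (k : nat) (B : 'I_k -> M) (gr : 'I_k -> grade)
    (z : grade) (v : M) (c : 'cV[K]_k) : Prop :=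
  (forall i, ~~ legr (gr i) z -> c i 0 = 0) /\
  v = \sum_(i < k | legr (gr i) z) term (c i 0) (z - gr i) *: B i.

End Bases.

(* [A], with columns labeled by [grB], represents [f] with respect to [B], [B']. *)
Definition represents (K : fieldType) (M M' : bipersMod K) (m n : nat)
    (A : 'M[K]_(m, n)) (f : M -> M')
    (B : 'I_n -> M) (grB : 'I_n -> grade)
    (B' : 'I_m -> M') (grB' : 'I_m -> grade) : Prop :=
  forall j, coords B' grB' (grB j) (f (B j)) (col j A).

Definition im_of (K : fieldType) (M M' : bipersMod K) (f : M -> M') (u : M') : Prop :=
  exists v, f v = u.

Section Groebner.
Variables (K : fieldType) (M : bipersMod K).
Variables (m : nat) (B : 'I_m -> M) (gr : 'I_m -> grade).

Definition pivot (c : 'cV[K]_m) (i : 'I_m) : Prop :=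
  c i 0 != 0 /\ forall k : 'I_m, (i < k)%N -> c k 0 = 0.

(* [is_LT u t] reads "u is homogeneous and nonzero, and t = LT(u)". *)
Definition is_LT (u t : M) : Prop :=
  exists (z : grade) (c : 'cV[K]_m) (i : 'I_m),
    [/\ hpart z u, coords B gr z u c, pivot c i
      & t = term (c i 0) (z - gr i) *: B i].

(* The submodule generated by the leading terms of the elements of [S]; for a
   homogeneous submodule N, [LTgen N] is L(N). *)
Definition LTgen (S : M -> Prop) : M -> Prop :=
  gen (fun t => exists2 u, S u & is_LT u t).

Definition is_groebner (N G : M -> Prop) : Prop :=
  hom_generates G N /\ (forall v, LTgen N v <-> LTgen G v).

Definition is_min_groebner (N G : M -> Prop) : Prop :=
  is_groebner N G /\
  forall G' : M -> Prop, (forall u, G' u -> G u) ->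
    is_groebner N G' -> forall u, G u -> G' u.

(* A list of pairs (v, z) enumerates, without repetition, a minimal Groebner
   basis of N; the pair (v, z) stands for the element of M_z with coordinate
   vector v, which must exist. *)
Definition lists_min_groebner (N : M -> Prop) (L : seq ('cV[K]_m * grade)) : Prop :=
  [/\ uniq L,
      forall p, p \in L -> exists u, hpart p.2 u /\ coords B gr p.2 u p.1
    & is_min_groebner N
        (fun u => exists p, [/\ p \in L, hpart p.2 u & coords B gr p.2 u p.1])].

End Groebner.

(* Storage consists of arrays of three kinds: index arrays with entries in nat,
   field arrays with entries in K, and label arrays whose entries are single
   coordinates of labels in Z^2.  Arrays are named by numbers fixed in the
   program text, so a program uses finitely many arrays; cells are addressed by
   computed indices.  A scalar variable is a cell with constant address.

   A program has no built-in constants of K other than 0 and 1.  Indices can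
   only be added and subtracted (not multiplied), and label coordinates can
   only be copied and compared, so that unit-cost operations on unbounded
   integers give no undue power. *)

Inductive iexp : Type :=
| ICst (k : nat)
| IGet (x : nat) (a : iexp)
| IAdd (e1 e2 : iexp)
| ISub (e1 e2 : iexp).

Inductive fexp : Type :=
| FZero
| FOne
| FGet (x : nat) (a : iexp)
| FAdd (e1 e2 : fexp)
| FSub (e1 e2 : fexp)
| FMul (e1 e2 : fexp)
| FInv (e : fexp).

Inductive bexp : Type :=
| BLeI (e1 e2 : iexp)
| BEqF (e1 e2 : fexp)
| BLeL (x : nat) (a : iexp) (y : nat) (b : iexp)
| BNot (e : bexp)
| BAnd (e1 e2 : bexp).

Inductive cmd : Type :=
| Skip
| ISet (x : nat) (a e : iexp)
| FSet (x : nat) (a : iexp) (e : fexp)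
| LCopy (x : nat) (a : iexp) (y : nat) (b : iexp)
| Seq (c1 c2 : cmd)
| If (b : bexp) (c1 c2 : cmd)
| While (b : bexp) (c : cmd).

(* Evaluating an expression takes one unit of time per node. *)

Fixpoint icost (e : iexp) : nat :=
  match e with
  | ICst _ => 1
  | IGet _ a => (icost a).+1
  | IAdd e1 e2 | ISub e1 e2 => (icost e1 + icost e2).+1
  end.

Fixpoint fcost (e : fexp) : nat :=
  match e with
  | FZero | FOne => 1
  | FGet _ a => (icost a).+1
  | FAdd e1 e2 | FSub e1 e2 | FMul e1 e2 => (fcost e1 + fcost e2).+1
  | FInv e => (fcost e).+1
  end.

Fixpoint bcost (e : bexp) : nat :=
  match e with
  | BLeI e1 e2 => (icost e1 + icost e2).+1
  | BEqF e1 e2 => (fcost e1 + fcost e2).+1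
  | BLeL _ a _ b => (icost a + icost b).+1
  | BNot e => (bcost e).+1
  | BAnd e1 e2 => (bcost e1 + bcost e2).+1
  end.

Section Machine.
Variable K : fieldType.

Record store : Type := Store {
  ival : nat -> nat -> nat;
  fval : nat -> nat -> K;
  lval : nat -> nat -> int }.

Definition upd (T : Type) (f : nat -> nat -> T) (x a : nat) (v : T) : nat -> nat -> T :=
  fun y b => if (y == x) && (b == a) then v else f y b.

Section Eval.
Variable st : store.

Fixpoint ieval (e : iexp) : nat :=
  match e with
  | ICst k => k
  | IGet x a => ival st x (ieval a)
  | IAdd e1 e2 => (ieval e1 + ieval e2)%N
  | ISub e1 e2 => (ieval e1 - ieval e2)%N
  end.

Fixpoint feval (e : fexp) : K :=
  match e with
  | FZero => 0
  | FOne => 1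
  | FGet x a => fval st x (ieval a)
  | FAdd e1 e2 => feval e1 + feval e2
  | FSub e1 e2 => feval e1 - feval e2
  | FMul e1 e2 => feval e1 * feval e2
  | FInv e => (feval e)^-1
  end.

Fixpoint beval (e : bexp) : bool :=
  match e with
  | BLeI e1 e2 => (ieval e1 <= ieval e2)%N
  | BEqF e1 e2 => feval e1 == feval e2
  | BLeL x a y b => lval st x (ieval a) <= lval st y (ieval b)
  | BNot e => ~~ beval e
  | BAnd e1 e2 => beval e1 && beval e2
  end.

(* All cells read by an expression have addresses below S. *)
Variable S : nat.

Fixpoint ifits (e : iexp) : bool :=
  match e with
  | ICst _ => true
  | IGet _ a => ifits a && (ieval a < S)%N
  | IAdd e1 e2 | ISub e1 e2 => ifits e1 && ifits e2
  end.

Fixpoint ffits (e : fexp) : bool :=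
  match e with
  | FZero | FOne => true
  | FGet _ a => ifits a && (ieval a < S)%N
  | FAdd e1 e2 | FSub e1 e2 | FMul e1 e2 => ffits e1 && ffits e2
  | FInv e => ffits e
  end.

Fixpoint bfits (e : bexp) : bool :=
  match e with
  | BLeI e1 e2 => ifits e1 && ifits e2
  | BEqF e1 e2 => ffits e1 && ffits e2
  | BLeL _ a _ b =>
      [&& ifits a, (ieval a < S)%N, ifits b & (ieval b < S)%N]
  | BNot e => bfits e
  | BAnd e1 e2 => bfits e1 && bfits e2
  end.

End Eval.

(* [exec S c st st' t]: when all arrays have length S, the command c started in
   st terminates in st' after t units of time, without any access out of
   bounds.  The memory used is S cells per array occurring in c, which for a
   fixed program is O(S). *)
Inductive exec (S : nat) : cmd -> store -> store -> nat -> Prop :=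
| ExSkip st : exec S Skip st st 1
| ExISet st x a e :
    ifits st S a -> ifits st S e -> (ieval st a < S)%N ->
    exec S (ISet x a e) st
      (Store (upd (ival st) x (ieval st a) (ieval st e)) (fval st) (lval st))
      (icost a + icost e).+1
| ExFSet st x a e :
    ifits st S a -> ffits st S e -> (ieval st a < S)%N ->
    exec S (FSet x a e) st
      (Store (ival st) (upd (fval st) x (ieval st a) (feval st e)) (lval st))
      (icost a + fcost e).+1
| ExLCopy st x a y b :
    ifits st S a -> ifits st S b -> (ieval st a < S)%N -> (ieval st b < S)%N ->
    exec S (LCopy x a y b) st
      (Store (ival st) (fval st)
         (upd (lval st) x (ieval st a) (lval st y (ieval st b))))
      (icost a + icost b).+1
| ExSeq st st1 st2 c1 c2 t1 t2 :
    exec S c1 st st1 t1 -> exec S c2 st1 st2 t2 ->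
    exec S (Seq c1 c2) st st2 (t1 + t2).+1
| ExIfT st st1 b c1 c2 t :
    bfits st S b -> beval st b -> exec S c1 st st1 t ->
    exec S (If b c1 c2) st st1 (bcost b + t).+1
| ExIfF st st1 b c1 c2 t :
    bfits st S b -> ~~ beval st b -> exec S c2 st st1 t ->
    exec S (If b c1 c2) st st1 (bcost b + t).+1
| ExWhileT st st1 st2 b c t1 t2 :
    bfits st S b -> beval st b ->
    exec S c st st1 t1 -> exec S (While b c) st1 st2 t2 ->
    exec S (While b c) st st2 (bcost b + t1 + t2).+1
| ExWhileF st b c :
    bfits st S b -> ~~ beval st b -> exec S (While b c) st st (bcost b).+1.

(* Input: m and n in cells 0 of index arrays 0 and 1, the matrix in field
   array 0 column by column, the labels in label arrays 0 and 1.  The contents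
   of all other cells are arbitrary. *)
Definition holds_input (m n : nat) (A : 'M[K]_(m, n)) (lab : 'I_n -> grade)
    (st : store) : Prop :=
  [/\ ival st 0 0 = m, ival st 1 0 = n,
      forall (i : 'I_m) (j : 'I_n), fval st 0 (j * m + i) = A i j
    & forall j : 'I_n, lval st 0 j = (lab j).1 /\ lval st 1 j = (lab j).2].

(* Output: the length of the list in cell 0 of index array 2, the coordinate
   vectors in field array 1 one after the other, the grades in label arrays 2
   and 3. *)
Definition output (m : nat) (st : store) : seq ('cV[K]_m * grade) :=
  mkseq (fun l => (\col_(i < m) fval st 1 (l * m + i),
                   (lval st 2 l, lval st 3 l)))
        (ival st 2 0).

End Machine.

(* Main.v *)
Require Import Defs.
From mathcomp Require Import all_boot all_order all_algebra.
From mathcomp.multinomials Require Import freeg mpoly.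
From mathcomp Require Import zify.

Set Implicit Arguments.
Unset Strict Implicit.
Unset Printing Implicit Defensive.

Import Order.TTheory GRing.Theory Num.Theory.
Local Open Scope ring_scope.

(** The columns are processed by increasing first coordinate [x] of their
    labels.  Once all columns with first coordinate at most [x] are in, the
    degree [(x, y)] part of the image is the span of those whose second
    coordinate is at most [y]; so at each stage one has to understand a single
    filtration by [y].  Subtracting from a column a multiple of a column with
    smaller or equal [y] changes none of the spans ([filt_addcol]), and such
    operations suffice to give all nonzero processed columns distinct pivots.
    Then the pivots that occur in degree [(x, y)] are those held by a column with
    second coordinate at most [y] ([filt_pivot]).

    A new column is inserted by walking down its rows.  If its current pivot is
    already held, the one of the two columns with the smaller [y] keeps (or takes
    over) the pivot, and the other one is reduced by it and carried on.  Hence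
    there is one column operation per held pivot, that is, at most [minn m n],
    and a pivot only ever passes to columns of smaller [y] ([wp_insert]).

    When [x] is finished, every pivot whose holder has changed yields the element
    with the column of the new holder and the grade formed by [x] and the [y] of
    that holder.  For a fixed pivot the recorded grades thus have increasing [x]
    and decreasing [y]; they are the minimal degrees in which the pivot occurs
    ([flushing_emit], [flushing_end]).  By [min_groebner_criterion] this makes the
    recorded elements a minimal Groebner basis.  That leading terms make sense at
    all, because a minimal generating set of a free module is linearly
    independent, is [basis_independent].

    The reduction takes place inside the input array.  Each [x] adds at most
    [minn m n] vectors of length [m] to the output, which gives the memory bound;
    the same count, together with a linear search for the next column, gives the
    time bound. *)

(** * Grades and terms *)

Section Grades.

Lemma legr_refl z : legr z z.
Proof. by rewrite /legr !lexx. Qed.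

Lemma legr_trans : transitive legr.
Proof.
move=> y x z /andP[a1 a2] /andP[b1 b2].
by rewrite /legr (le_trans a1 b1) (le_trans a2 b2).
Qed.

Definition expo (d : grade) : 'X_{1..2} :=
  [multinom (if i == ord0 then absz d.1 else absz d.2) | i < 2].

Definition expo_grade (k : 'X_{1..2}) : grade :=
  ((k ord0 : nat)%:Z, (k ord_max : nat)%:Z).

Lemma expoK d : legr 0 d -> expo_grade (expo d) = d.
Proof.
case: d => d1 d2 /andP[/= h1 h2].
by rewrite /expo_grade !mnmE /= !gez0_abs.
Qed.

Lemma expo_gradeK : cancel expo_grade expo.
Proof.
move=> k; apply/mnmP => i; rewrite mnmE /=.
by case: i => -[|[|[]]] //= hi; congr (k _); apply: val_inj.
Qed.

Lemma expo_gradeD k l : expo_grade (k + l)%MM = expo_grade k + expo_grade l.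
Proof. by rewrite /expo_grade !mnmDE !PoszD. Qed.

Lemma expoD d e : legr 0 d -> legr 0 e -> expo (d + e) = (expo d + expo e)%MM.
Proof.
move=> hd he; apply: (can_inj expo_gradeK); rewrite expo_gradeD !expoK //.
by case/andP: hd he => a b /andP[c e']; rewrite /legr /= !addr_ge0.
Qed.

Lemma legr_add z d : legr 0 d -> legr z (z + d).
Proof. by case/andP=> a b; rewrite /legr /= !lerDl a b. Qed.

End Grades.

Section Terms.
Variable K : fieldType.
Implicit Types (c a b : K) (d e : grade).

Lemma term_mon c d : term c d = c *: 'X_[expo d].
Proof. exact: termE. Qed.

Lemma term0 d : term (0 : K) d = 0.
Proof. by rewrite term_mon scale0r. Qed.

Lemma termD c b d : term (c + b) d = term c d + term b d.
Proof. by rewrite !term_mon scalerDl. Qed.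

Lemma term_scale c b d : c%:MP * term b d = term (c * b) d.
Proof. by rewrite !term_mon mul_mpolyC scalerA. Qed.

Lemma termM c b d e : legr 0 d -> legr 0 e ->
  term c d * term b e = term (c * b) (d + e).
Proof.
by move=> hd he; rewrite !term_mon -scalerAr -scalerAl scalerA expoD // mpolyXD mulrC.
Qed.

Lemma term_sum (I : Type) (r : seq I) (P : pred I) (F : I -> K) d :
  \sum_(i <- r | P i) term (F i) d = term (\sum_(i <- r | P i) F i) d.
Proof.
by rewrite term_mon scaler_suml; apply: eq_bigr => i _; rewrite term_mon.
Qed.

Lemma term_coef c d : (term c d)@_(expo d) = c.
Proof. by rewrite term_mon mcoeffZ mcoeffX eqxx mulr1. Qed.

Lemma term1_0 : term (1 : K) 0 = 1.
Proof. by rewrite /term !expr0 !mulr1. Qed.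

End Terms.

Lemma big_seq_pred1 (V : nmodType) (T : eqType) (s : seq T) (F : T -> V) i :
  uniq s -> i \in s -> \sum_(j <- s | j == i) F j = F i.
Proof. by move=> us si; rewrite -big_filter filter_pred1_uniq // big_seq1. Qed.

(** * Homogeneous components *)

Section HomogeneousParts.
Variables (K : fieldType) (M : bipersMod K).
Implicit Types (u v : M) (z w : grade).

Lemma hpartD z u v : hpart z u -> hpart z v -> hpart z (u + v).
Proof. by move=> hu hv; have := hpart_lin 1 hu hv; rewrite mpolyC1 scale1r. Qed.

Lemma hpartZ z (c : K) u : hpart z u -> hpart z (c%:MP *: u).
Proof. by move=> hu; have := hpart_lin c hu (hpart0 M z); rewrite addr0. Qed.

Lemma hpartN z u : hpart z u -> hpart z (- u).
Proof. by move/(hpartZ (-1)); rewrite mpolyCN mpolyC1 scaleN1r. Qed.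

Lemma hpart_sum z (I : eqType) (r : seq I) (P : pred I) (F : I -> M) :
  (forall i, i \in r -> P i -> hpart z (F i)) ->
  hpart z (\sum_(i <- r | P i) F i).
Proof.
move=> h; rewrite big_seq_cond.
apply: (big_ind (hpart z)) => [|x y|i /andP[ir Pi]]; first exact: hpart0.
  exact: hpartD.
exact: h.
Qed.

Lemma hpartXn i k z v :
  hpart z v -> hpart (z + unit_grade i *+ k) ('X_i ^+ k *: v).
Proof.
move=> hv; elim: k => [|k IH]; first by rewrite mulr0n addr0 scale1r.
by rewrite mulrSr addrA exprS -scalerA; apply: hpartX.
Qed.

Lemma hpart_mon k z v : hpart z v -> hpart (z + expo_grade k) ('X_[k] *: v).
Proof.
move=> hv; have -> : 'X_[k] = 'X_ord_max ^+ k ord_max * 'X_ord0 ^+ k ord0 :> {mpoly K[2]}.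
  rewrite !mpolyXn -mpolyXD; congr mpolyX; apply/mnmP => i.
  rewrite mnmDE !mulmnE !mnm1E.
  case: i => -[|[|[]]] //= hi; rewrite /= ?muln1 ?muln0 ?addn0 ?add0n ?mul1n ?mul0n;
    congr (k _); exact: val_inj.
rewrite -scalerA.
have -> : z + expo_grade k =
    (z + unit_grade ord0 *+ k ord0) + unit_grade ord_max *+ k ord_max.
  rewrite -addrA; congr (_ + _); rewrite /unit_grade /= /expo_grade.
  rewrite [RHS]surjective_pairing /= !raddfMn /= !mul0rn addr0 add0r.
  by rewrite !natz.
by do 2! apply: hpartXn.
Qed.

Lemma hpart_term z w c v :
  legr z w -> hpart z v -> hpart w (term c (w - z) *: v).
Proof.
move=> zw hv; rewrite term_mon -mul_mpolyC -scalerA; apply: hpartZ.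
have := hpart_mon (expo (w - z)) hv.
by rewrite expoK ?legr_sub // [z + _]addrC subrK.
Qed.

(** The difference between [v] and the terms of degree [z] is absorbed into a sum
    of homogeneous elements of distinct degrees equal to zero. *)
Lemma hpart_component z v (T : eqType) (l : seq T) (d : T -> grade) (f : T -> M) :
  (forall t, t \in l -> hpart (d t) (f t)) ->
  hpart z v -> v = \sum_(t <- l) f t -> v = \sum_(t <- l | d t == z) f t.
Proof.
move=> hf hv Ev; pose s := undup (z :: map d l).
pose g w := \sum_(t <- l | d t == w) f t - (if w == z then v else 0).
have us : uniq s by apply: undup_uniq.
have zs : z \in s by rewrite mem_undup inE eqxx.
have hg w : hpart w (g w).
  apply: hpartD; first by apply: hpart_sum => t tl /eqP <-; apply: hf.
  by apply: hpartN; case: eqP => [->|_] //; apply: hpart0.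
have sum0 : \sum_(w <- s) g w = 0.
  rewrite sumrB -big_mkcond big_seq_pred1 //.
  rewrite (exchange_big_dep predT) //= Ev -sumrB big_seq big1 // => t tl.
  under eq_bigl => w do rewrite eq_sym.
  rewrite big_seq_pred1 ?subrr // mem_undup inE; apply/orP; right.
  exact: map_f.
have := hpart_indep us hg sum0 zs; rewrite /g eqxx => /eqP.
by rewrite subr_eq0 => /eqP.
Qed.

(** In a polynomial combination of homogeneous elements that is itself
    homogeneous, each coefficient may be replaced by its only monomial of the
    right degree. *)
Lemma homogeneous_comb z v (T : eqType) (l : seq T) (d : T -> grade)
    (p : T -> {mpoly K[2]}) (b : T -> M) :
  (forall t, t \in l -> hpart (d t) (b t)) ->
  hpart z v -> v = \sum_(t <- l) p t *: b t ->
  v = \sum_(t <- l | legr (d t) z)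
        term (p t)@_(expo (z - d t)) (z - d t) *: b t.
Proof.
move=> hb hv Ev.
pose l' := [seq (t, k) | t <- l, k <- msupp (p t)].
have hl' (q : T * 'X_{1..2}) : q \in l' ->
    hpart (d q.1 + expo_grade q.2) (((p q.1)@_q.2 *: 'X_[q.2]) *: b q.1).
  case/allpairsPdep => t [k [tl _ ->]] /=.
  by rewrite -mul_mpolyC -scalerA; apply/hpartZ/hpart_mon/hb.
have Ev' : v = \sum_(q <- l') ((p q.1)@_q.2 *: 'X_[q.2]) *: b q.1.
  rewrite Ev big_allpairs_dep /=; apply: eq_bigr => t _.
  by rewrite {1}[p t]mpolyE scaler_suml.
rewrite (hpart_component hl' hv Ev') big_mkcond big_allpairs_dep /=.
rewrite [RHS]big_mkcond; apply: eq_bigr => t _ /=.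
rewrite -big_mkcond /=; case: ifP => [le_z|/negP nle]; last first.
  by rewrite big1 // => k /eqP e; case: nle; rewrite -e legr_add.
under eq_bigl => k.
  have -> : (d t + expo_grade k == z) = (k == expo (z - d t)).
    apply/eqP/eqP => [<-|->]; first by rewrite [d t + _]addrC addrK expo_gradeK.
    by rewrite expoK ?legr_sub // addrC subrK.
  over.
case: (boolP (expo (z - d t) \in msupp (p t))) => hk.
  by rewrite big_seq_pred1 ?msupp_uniq // term_mon.
rewrite (memN_msupp_eq0 hk) term0 scale0r big_seq_cond big1 // => k.
by case/andP => kp /eqP e; rewrite e (negPf hk) in kp.
Qed.

End HomogeneousParts.
(** * Generating sets and coordinates *)

Lemma seq_choice (T : eqType) (U : Type) (u0 : U) (P : T -> U -> Prop) (l : seq T) :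
  (forall t, t \in l -> exists u, P t u) ->
  exists f, forall t, t \in l -> P t (f t).
Proof.
elim: l => [|a l IH] h; first by exists (fun=> u0).
have [|f hf] := IH; first by move=> t tl; apply: h; rewrite inE tl orbT.
have [u hu] := h a (mem_head _ _).
exists (fun t => if t == a then u else f t) => t; rewrite inE.
by case: eqP => [->|_] //=; apply: hf.
Qed.

Section Generation.
Variables (K : fieldType) (M : bipersMod K).
Implicit Types (S N : M -> Prop) (u v : M).

Lemma gen_in S v : S v -> gen S v.
Proof.
move=> Sv; exists [:: (1, v)]; split; last by rewrite big_seq1 scale1r.
by move=> q; rewrite inE => /eqP ->.
Qed.

Lemma gen0 S : gen S 0.
Proof. by exists [::]; split=> //; rewrite big_nil. Qed.

Lemma genD S u v : gen S u -> gen S v -> gen S (u + v).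
Proof.
move=> [l [hl ->]] [r [hr ->]]; exists (l ++ r); split; last by rewrite big_cat.
by move=> q; rewrite mem_cat => /orP[/hl|/hr].
Qed.

Lemma genZ S (p : {mpoly K[2]}) u : gen S u -> gen S (p *: u).
Proof.
move=> [l [hl ->]]; exists [seq (p * q.1, q.2) | q <- l]; split.
  by move=> q /mapP[r rl ->]; apply: hl rl.
by rewrite big_map scaler_sumr; apply: eq_bigr => q _; rewrite scalerA.
Qed.

Lemma gen_sum S (I : eqType) (r : seq I) (P : pred I) (F : I -> M) :
  (forall i, i \in r -> P i -> gen S (F i)) -> gen S (\sum_(i <- r | P i) F i).
Proof.
move=> h; rewrite big_seq_cond.
apply: (big_ind (gen S)) => [|x y|i /andP[ir Pi]]; first exact: gen0.
  exact: genD.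
exact: h.
Qed.

Lemma gen_sub S N v : (forall u, S u -> gen N u) -> gen S v -> gen N v.
Proof.
move=> SN [l [hl ->]]; apply: gen_sum => q ql _.
by apply/genZ/SN/hl.
Qed.

Lemma gen_family (k : nat) (B : 'I_k -> M) v :
  gen (fun b => exists i, B i = b) v ->
  exists p : 'I_k -> {mpoly K[2]}, v = \sum_i p i *: B i.
Proof.
case=> l [hl ->]; elim: l hl => [|q l IH] hl.
  by exists (fun=> 0); rewrite big_nil big1 // => i _; rewrite scale0r.
have [|p Ep] := IH; first by move=> r rl; apply: hl; rewrite inE rl orbT.
have [i Ei] := hl q (mem_head _ _).
exists (fun j => p j + (if j == i then q.1 else 0)).
rewrite big_cons Ep addrC -Ei.
under [in RHS]eq_bigr => j _ do rewrite scalerDl.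
rewrite big_split /=; congr (_ + _).
rewrite (bigD1 i) //= eqxx big1 ?addr0 // => j /negPf ->.
by rewrite scale0r.
Qed.

End Generation.

Section Coordinates.
Variables (K : fieldType) (M : bipersMod K).
Variables (k : nat) (B : 'I_k -> M) (gr : 'I_k -> grade).
Hypothesis hB : forall i, hpart (gr i) (B i).
Implicit Types (u v : M) (z w : grade) (c d : 'cV[K]_k).

Lemma coords_hpart z v c : coords B gr z v c -> hpart z v.
Proof. by case=> _ ->; apply: hpart_sum => i _ iz; apply: hpart_term. Qed.

Lemma coords0 z : coords B gr z 0 0.
Proof.
split=> [i _|]; first by rewrite mxE.
by rewrite big1 // => i _; rewrite mxE term0 scale0r.
Qed.

Lemma coordsD z u v c d :
  coords B gr z u c -> coords B gr z v d -> coords B gr z (u + v) (c + d).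
Proof.
move=> [hc ->] [hd ->]; split=> [i iz|]; first by rewrite mxE hc ?hd ?addr0.
by rewrite -big_split; apply: eq_bigr => i _ /=; rewrite -scalerDl -termD mxE.
Qed.

Lemma coords_term z w a u c : legr z w ->
  coords B gr z u c -> coords B gr w (term a (w - z) *: u) (a *: c).
Proof.
move=> zw [hc ->]; split=> [i iw|].
  rewrite mxE hc ?mulr0 //; apply: contraNN iw => iz; exact: legr_trans zw.
rewrite scaler_sumr [RHS]big_mkcond [LHS]big_mkcond; apply: eq_bigr => i _ /=.
case: (boolP (legr _ z)) => iz.
  rewrite (legr_trans iz zw) scalerA termM ?legr_sub // mxE.
  by rewrite addrA subrK.
by case: ifP => // _; rewrite mxE hc // mulr0 term0 scale0r.
Qed.

Lemma coordsZ z a u c : coords B gr z u c -> coords B gr z (a%:MP *: u) (a *: c).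
Proof.
move/(coords_term a (legr_refl z)).
by rewrite subrr /term !expr0 !mulr1.
Qed.

Lemma coords_sum z (I : eqType) (r : seq I) (P : pred I) (F : I -> M)
    (c : I -> 'cV[K]_k) :
  (forall i, i \in r -> P i -> coords B gr z (F i) (c i)) ->
  coords B gr z (\sum_(i <- r | P i) F i) (\sum_(i <- r | P i) c i).
Proof.
move=> h; rewrite big_seq_cond [X in coords _ _ _ _ X]big_seq_cond.
apply: (big_ind2 (coords B gr z)) => [|u c1 v c2|i /andP[ir Pi]].
- exact: coords0.
- exact: coordsD.
exact: h.
Qed.

Lemma coords_basis i : coords B gr (gr i) (B i) (delta_mx i 0).
Proof.
split=> [j ji|].
  by rewrite mxE; case: eqP ji => [->|//]; rewrite legr_refl.
rewrite (bigD1 i) ?legr_refl //= mxE !eqxx subrr term1_0 scale1r.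
rewrite big1 ?addr0 // => j /andP[_ /negPf ji].
by rewrite mxE ji term0 scale0r.
Qed.

Lemma coords_exists z v :
  gen (fun b => exists i, B i = b) v -> hpart z v -> exists c, coords B gr z v c.
Proof.
move=> /gen_family[p Ep] hv.
have := homogeneous_comb (fun i _ => hB i) hv Ep.
set F := fun i => (p i)@_(expo (z - gr i)) => E.
exists (\col_i (if legr (gr i) z then F i else 0)); split=> [i /negPf iz|].
  by rewrite mxE iz.
by rewrite E; apply: eq_bigr => i iz; rewrite mxE iz.
Qed.

End Coordinates.

Section Independence.
Variables (K : fieldType) (M : bipersMod K).
Variables (k : nat) (B : 'I_k -> M) (gr : 'I_k -> grade).
Hypothesis basisB : ordered_basis B gr.

Let hB i : hpart (gr i) (B i).
Proof. by case: basisB. Qed.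

(** A nonzero coefficient at a basis element of the degree of the relation would
    express this element by the other ones. *)
Lemma relation_minimal z c i : coords B gr z 0 c -> gr i = z -> c i 0 = 0.
Proof.
case=> _ E ziE; apply/eqP/negPn/negP => ci.
case: basisB => injB [[homB genB] minB] _.
pose S' b := exists2 j, j != i & B j = b.
have Bi : gen S' (B i).
  have -> : B i = \sum_(j | legr (gr j) z && (j != i))
      (- (c i 0)^-1)%:MP *: (term (c j 0) (z - gr j) *: B j).
    move/eqP: E; rewrite (bigD1 i) /= -ziE ?legr_refl // subrr.
    rewrite eq_sym addr_eq0 => /eqP/(congr1 (fun u => (c i 0)^-1%:MP *: u)).
    rewrite scalerN scaler_sumr scalerA term_scale mulVf // term1_0 scale1r => ->.
    rewrite -sumrN; apply: eq_bigr => j _.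
    by rewrite mpolyCN scaleNr.
  apply: gen_sum => j _ /andP[_ ji]; do 2! apply: genZ.
  by apply: gen_in; exists j.
have [||j /negP ji /injB] := minB S' _ _ (B i) (ex_intro _ i erefl).
- by move=> b [j _ <-]; exists j.
- split=> [b [j _ <-]|v]; first by exists (gr j).
  split=> // _; have /gen_family[p ->] := (genB v).2 I.
  apply: gen_sum => j _ _; apply: genZ; have [->|ji] := eqVneq j i => //.
  by apply: gen_in; exists j.
by move/eqP.
Qed.

(** Writing the standard generators of the free module and the given ones in
    terms of each other yields a matrix [Q] over [K] that sends
    the [j]-th unit vector to coordinates of [B j] and every relation to zero.
    By minimality [1 - Q] only has entries at pairs of strictly increasing
    grades, so it is nilpotent; as it fixes every relation, there is none. *)
Lemma basis_independent z c : is_free M -> coords B gr z 0 c -> c = 0.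
Proof.
case=> I [g [f [f' [hf hf' fK f'K]]]] rel_c.
have genB v : gen (fun b => exists i, B i = b) v.
  by case: basisB => _ [[_ h] _] _; apply/h.
pose phi i j : K := (freeg.coeff i (f (B j)))@_(expo (gr j - g i)).
have coeffB i j : freeg.coeff i (f (B j)) =
    if legr (g i) (gr j) then term (phi i j) (gr j - g i) else 0.
  have := hf _ _ (hB j) i; rewrite /Qcomp; case: ifP => // _ [a Ea].
  by rewrite /phi Ea term_coef.
have phi0 i j : ~~ legr (g i) (gr j) -> phi i j = 0.
  by move=> /negPf h; rewrite /phi coeffB h mcoeff0.
pose D := undup (flatten [seq dom (f (B j)) | j <- enum 'I_k]).
pose e i : dsumQ K g := << 1 *g i >>.
have he i : hpart (g i) (f' (e i)).
  apply: hf' => i'; rewrite coeffU /Qcomp.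
  case: (i =P i') => [<-|_]; last by rewrite mulr0; case: ifP => // _; exists 0; rewrite term0.
  by rewrite legr_refl subrr mulr1; exists 1; rewrite term1_0.
(* Only the finitely many standard generators occurring in the [B j] matter. *)
have [s hs] : exists s : I -> 'cV[K]_k,
    forall i, i \in D -> coords B gr (g i) (f' (e i)) (s i).
  apply: (@seq_choice _ _ 0 (fun i c => coords B gr (g i) (f' (e i)) c)) => i _.
  exact: coords_exists.
have EB j : B j = \sum_(i <- D | legr (g i) (gr j))
    term (phi i j) (gr j - g i) *: f' (e i).
  apply: (can_inj fK); rewrite raddf_sum /=.
  apply/eqP/freeg_eqP => i; rewrite raddf_sum /=.
  under eq_bigr => i' _ do rewrite linearZ /= f'K coeffZ coeffU mul1r.
  case: (boolP (i \in D)) => iD; last first.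
    rewrite big1_seq => [|i' /andP[_ i'D]].
      apply: coeff_outdom; apply: contra iD => idom; rewrite mem_undup.
      by apply/flattenP; exists (dom (f (B j))) => //; apply: map_f; rewrite mem_enum.
    by case: eqP => [e'|_]; rewrite ?mulr0 // -e' i'D in iD *.
  rewrite coeffB; case: ifP => ij.
    rewrite (big_rem i iD) /= ij eqxx mulr1 big1_seq ?addr0 // => i' /andP[_].
    rewrite mem_rem_uniq ?undup_uniq // inE => /andP[/negPf -> _].
    by rewrite mulr0.
  rewrite big1 // => i' le'; case: eqP => [e'|_]; rewrite ?mulr0 //.
  by rewrite -e' le' in ij.
pose Q j := \sum_(i <- D | legr (g i) (gr j)) phi i j *: s i.
have rel_Q j : coords B gr (gr j) 0 (delta_mx j 0 - Q j).
  have cQ : coords B gr (gr j) (B j) (Q j).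
    by rewrite [X in coords _ _ _ X]EB; apply: coords_sum => i iD le; apply/coords_term/hs.
  have := coordsD (coords_basis B gr j) (coordsZ (-1) cQ).
  by rewrite mpolyCN mpolyC1 !scaleN1r subrr.
have phi_c i : \sum_j phi i j * c j 0 = 0.
  case: rel_c => supp_c /(congr1 (fun v => freeg.coeff i (f v))).
  rewrite raddf0 coeff0 raddf_sum raddf_sum /=.
  under eq_bigr => j _ do rewrite linearZ /= coeffZ coeffB.
  case: (boolP (legr (g i) z)) => iz E; last first.
    rewrite big1 // => j _; case: (boolP (legr (gr j) z)) => jz.
      rewrite phi0 ?mul0r //; apply: contra iz => ij; exact: legr_trans jz.
    by rewrite supp_c ?mulr0.
  have {}E : term (\sum_j phi i j * c j 0) (z - g i) = 0.
    rewrite -term_sum [RHS]E (bigID (fun j => legr (gr j) z)) /=.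
    rewrite addrC big1 ?add0r => [|j jz]; last by rewrite supp_c ?mulr0 ?term0.
    apply: eq_bigr => j jz; case: ifP => [ij|/negbT ij].
      by rewrite termM ?legr_sub // addrA subrK mulrC.
    by rewrite phi0 // mul0r term0 mulr0.
  by have := term_coef (\sum_j phi i j * c j 0) (z - g i); rewrite E mcoeff0.
have Qc l : \sum_j Q j l 0 * c j 0 = 0.
  under eq_bigr => j _.
    rewrite /Q summxE mulr_suml big_mkcond /=.
    under eq_bigr => i _.
      rewrite (_ : (if _ then _ else _) = s i l 0 * (phi i j * c j 0)); last first.
        case: ifP => [_|/negbT ij]; first by rewrite mxE mulrCA mulrA.
        by rewrite phi0 // mul0r mulr0.
    over.
  over.
  by rewrite exchange_big /= big1 // => i _; rewrite -mulr_sumr phi_c mulr0.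
have fixc l : c l 0 = \sum_j (delta_mx j 0 - Q j) l 0 * c j 0.
  have E j : (delta_mx j 0 - Q j) l 0 * c j 0 =
      (l == j)%:R * c j 0 - Q j l 0 * c j 0.
    by rewrite !mxE eqxx andbT mulrDl mulNr.
  under eq_bigr => j _ do rewrite E.
  rewrite sumrB Qc subr0 (bigD1 l) //= eqxx mul1r.
  by rewrite big1 ?addr0 // => j; rewrite eq_sym => /negPf ->; rewrite mul0r.
(* The nilpotence of [1 - Q], as an induction on the distance from [gr l] to [z]. *)
pose rest l := (absz (z.1 - (gr l).1) + absz (z.2 - (gr l).2))%N.
have zero n l : (rest l < n)%N -> c l 0 = 0.
  elim: n l => [//|n IH] l hl.
  case: (boolP (legr (gr l) z)) => lz; last by case: rel_c => ->.
  rewrite fixc big1 // => j _.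
  case: (boolP (legr (gr j) z)) => jz; last by case: rel_c => -> //; rewrite mulr0.
  case: (boolP (legr (gr l) (gr j))) => lj; last by case: (rel_Q j) => -> //; rewrite mul0r.
  have [/eqP lj_eq|lj_ne] := boolP (gr l == gr j).
    by rewrite (relation_minimal (rel_Q j) lj_eq) mul0r.
  rewrite IH ?mulr0 //; move: hl lj_ne lz lj jz; rewrite /rest /legr.
  case: (gr l) => l1 l2; case: (gr j) => j1 j2; rewrite -pair_eqE /=.
  rewrite /=; lia.
by apply/colP => l; rewrite mxE (zero _ l (leqnn _)).
Qed.

Lemma coords_unique z v c d : is_free M ->
  coords B gr z v c -> coords B gr z v d -> c = d.
Proof.
move=> fM hc hd; apply/eqP; rewrite -subr_eq0; apply/eqP.
apply: (@basis_independent z) => //.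
have := coordsD hc (coordsZ (-1) hd).
by rewrite mpolyCN mpolyC1 !scaleN1r subrr.
Qed.

End Independence.
(** * The image and a criterion for minimal Groebner bases *)

Section Pivots.
Variables (K : fieldType) (m : nat).
Implicit Types (c d : 'cV[K]_m) (i j : 'I_m).

Lemma pivot_unique c i j : pivot c i -> pivot c j -> i = j.
Proof.
move=> [ci hi] [cj hj]; apply: val_inj.
by case: (ltngtP i j) => // [/hi e|/hj e]; rewrite e eqxx in ci cj.
Qed.

Lemma pivot_neq0 c i : pivot c i -> c != 0.
Proof. by case=> ci _; apply: contraNneq ci => ->; rewrite mxE. Qed.

End Pivots.

Lemma memv_sum_lines (K : fieldType) (vT : vectType K) (I : finType) (P : pred I)
    (a : I -> vT) v :
  v \in (\sum_(i | P i) <[a i]>)%VS ->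
  exists c : I -> K, v = \sum_(i | P i) c i *: a i.
Proof.
move=> /memv_sumP[w hw ->].
have [c hc] : exists c : I -> K, forall i, i \in enum P -> w i = c i *: a i.
  apply: (@seq_choice _ _ 0 (fun i b => w i = b *: a i)) => i.
  by rewrite mem_enum => Pi; apply/vlineP/hw.
by exists c; apply: eq_bigr => i Pi; apply: hc; rewrite mem_enum.
Qed.

Section Image.
Variables (K : fieldType) (m n : nat) (A : 'M[K]_(m, n)) (lab : 'I_n -> grade).

(** Coordinate vectors of the degree [z] part of the image. *)
Definition im_space (z : grade) : {vspace 'cV[K]_m} :=
  (\sum_(j | legr (lab j) z) <[col j A]>)%VS.

Variables (F F' : bipersMod K) (B : 'I_n -> F).
Variables (B' : 'I_m -> F') (gr' : 'I_m -> grade) (gamma : {linear F -> F'}).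
Hypotheses (freeF' : is_free F') (basisB : ordered_basis B lab).
Hypotheses (basisB' : ordered_basis B' gr') (gamma_graded : graded gamma).
Hypothesis gamma_A : represents A gamma B lab B' gr'.

Let uniqB' z v c d := @coords_unique K F' m B' gr' basisB' z v c d freeF'.

Lemma im_space_lift z w : w \in im_space z ->
  exists2 u, im_of gamma u & coords B' gr' z u w.
Proof.
move=> /memv_sum_lines[c ->].
exists (gamma (\sum_(j | legr (lab j) z) term (c j) (z - lab j) *: B j)).
  by eexists.
rewrite raddf_sum; apply: coords_sum => j _ jz /=.
by rewrite linearZ; apply/coords_term/gamma_A.
Qed.

(** As [gamma] preserves degrees, a homogeneous value is the value of the
    component of its degree. *)
Lemma im_component v z : exists2 v', hpart z v' &
  hpart z (gamma v) -> gamma v = gamma v'.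
Proof.
have [l [hl ->]] := hpart_span v.
exists (\sum_(q <- l | q.1 == z) q.2).
  by apply: hpart_sum => q ql /eqP <-; apply: hl.
move=> hz; rewrite [RHS]raddf_sum /=.
apply: (hpart_component (d := fst)) => // [q ql|]; last exact: raddf_sum.
exact/gamma_graded/hl.
Qed.

Lemma im_space_coords z u : hpart z u -> im_of gamma u ->
  exists2 w, w \in im_space z & coords B' gr' z u w.
Proof.
move=> hu [v Ev]; rewrite -{}Ev in hu *.
have [v' hv' -> //] := im_component v z.
have [_ [[_ genB] _] hB] := basisB.
have [c [_ Ec]] := coords_exists hB ((genB v').2 I) hv'.
exists (\sum_(j | legr (lab j) z) c j 0 *: col j A).
  by apply: memv_sumr => j jz; apply/rpredZ/memv_line.
rewrite Ec raddf_sum; apply: coords_sum => j _ jz /=.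
by rewrite linearZ; apply/coords_term/gamma_A.
Qed.

Lemma coords_im_space z u w :
  im_of gamma u -> coords B' gr' z u w -> w \in im_space z.
Proof.
move=> imu cu; have [_ _ hB'] := basisB'.
have [w' w'z cu'] := im_space_coords (coords_hpart hB' cu) imu.
by rewrite (uniqB' cu cu').
Qed.

Lemma coords_inj z u v w : coords B' gr' z u w -> coords B' gr' z v w -> u = v.
Proof. by move=> [_ ->] [_ ->]. Qed.

Lemma im_of_gen S v : (forall u, S u -> im_of gamma u) -> gen S v -> im_of gamma v.
Proof.
move=> hS [l [hl ->]]; elim: l hl => [|q l IH] hl.
  by exists 0; rewrite raddf0 big_nil.
have [|v' Ev'] := IH; first by move=> r rl; apply: hl; rewrite inE rl orbT.
have [w Ew] := hS _ (hl q (mem_head _ _)).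
by exists (q.1 *: w + v'); rewrite big_cons raddfD /= linearZ /= Ew Ev'.
Qed.

Lemma pivot_supported z u w p : coords B' gr' z u w -> pivot w p -> legr (gr' p) z.
Proof.
by case=> h _ [wp _]; apply: contraNT wp => /h ->.
Qed.

Lemma hpart_grade_unique z z' (u : F') : u <> 0 -> hpart z u -> hpart z' u -> z = z' :> grade.
Proof.
move=> u0 hz hz'.
have h := @hpart_component _ F' z u _ [:: u] (fun=> z') id.
have := h _ hz _; rewrite big_seq1 big_mkcond big_seq1.
case: eqP => // _ /(_ _ erefl) E; case: u0; apply: E => t.
by rewrite inE => /eqP ->.
Qed.

(** Coordinatewise criterion: elements of the image whose leading terms realize
    every pivot in every degree form a Groebner basis, because subtracting
    multiples of them lowers pivots until nothing is left; it is minimal when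
    elements with the same pivot have incomparable degrees, as then no leading
    term is in the module generated by the other ones. *)
Lemma min_groebner_criterion (L : seq ('cV[K]_m * grade)) :
  uniq L ->
  (forall e, e \in L -> e.1 \in im_space e.2 /\ exists p, pivot e.1 p) ->
  (forall z w p, w \in im_space z -> pivot w p ->
     exists e, [/\ e \in L, legr e.2 z & pivot e.1 p]) ->
  (forall e1 e2 p, e1 \in L -> e2 \in L -> pivot e1.1 p -> pivot e2.1 p ->
     legr e1.2 e2.2 -> e1 = e2) ->
  lists_min_groebner B' gr' (im_of gamma) L.
Proof.
move=> uL L_im L_full L_anti; have [_ _ hB'] := basisB'.
have L_elt e : e \in L -> exists u,
    [/\ im_of gamma u, hpart e.2 u & coords B' gr' e.2 u e.1].
  move=> eL; have [u imu cu] := im_space_lift (L_im e eL).1.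
  by exists u; split=> //; apply: coords_hpart cu.
set G := fun u => exists p, [/\ p \in L, hpart p.2 u & coords B' gr' p.2 u p.1].
have G_im u : G u -> im_of gamma u.
  case=> e [eL _ cu]; have [u' [imu' _ cu']] := L_elt e eL.
  by rewrite (coords_inj cu cu').
(* [b] bounds the pivot of the coordinate vector. *)
have gen_coords b : forall z u w, im_of gamma u -> coords B' gr' z u w ->
    (forall i : 'I_m, (b <= i)%N -> w i 0 = 0) -> gen G u.
  elim: b => [|b IH] z u w imu cu wb.
    have w0 : w = 0 by apply/colP => i; rewrite wb ?mxE.
    by rewrite w0 in cu; rewrite (coords_inj cu (coords0 B' gr' z)); apply: gen0.
  case: (ltnP b m) => bm; last first.
    by apply: IH imu cu _ => i bi; have := ltn_ord i; rewrite ltnNge (leq_trans bm bi).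
  pose p := Ordinal bm.
  have wp (r : 'I_m) : (b <= r)%N -> r != p -> w r 0 = 0.
    by move=> br rp; apply: wb; rewrite ltn_neqAle eq_sym rp.
  have [w0|w0] := eqVneq (w p 0) 0.
    by apply: IH imu cu _ => i bi; have [->//|/wp->] := eqVneq i p.
  have piv : pivot w p by split=> // i pi; apply: wb.
  have [e [eL ez ep]] := L_full z w p (coords_im_space imu cu) piv.
  have [g [[h Eh] hg cg]] := L_elt e eL.
  pose a := w p 0 / e.1 p 0.
  have -> : u = (u - term a (z - e.2) *: g) + term a (z - e.2) *: g by rewrite subrK.
  apply: genD; last by apply/genZ/gen_in; exists e.
  have cu' : coords B' gr' z (u - term a (z - e.2) *: g) (w - a *: e.1).
    have := coordsD cu (coordsZ (-1) (coords_term a ez cg)).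
    by rewrite mpolyCN mpolyC1 !scaleN1r.
  apply: IH cu' _ => [|i bi].
    case: imu => h' Eh'; exists (h' - term a (z - e.2) *: h).
    by rewrite raddfB /= linearZ /= Eh Eh'.
  rewrite !mxE; have [->|ip] := eqVneq i p; first by rewrite divfK ?subrr ?ep.1.
  by rewrite wp // ep.2 ?mulr0 ?subr0 // ltn_neqAle bi andbT eq_sym.
have G_gen u : gen G u <-> im_of gamma u.
  split; first exact: im_of_gen.
  case=> v <-; have [l [hl ->]] := hpart_span v.
  rewrite raddf_sum; apply: gen_sum => q ql _.
  have imq : im_of gamma (gamma q.2) by exists q.2.
  have [w _ cw] := im_space_coords (gamma_graded (hl q ql)) imq.
  by apply: (gen_coords m _ _ _ imq cw) => i; rewrite leqNgt ltn_ord.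
have LT_elt e u p : e \in L -> coords B' gr' e.2 u e.1 -> pivot e.1 p ->
    is_LT B' gr' u (term (e.1 p 0) (e.2 - gr' p) *: B' p).
  by move=> eL cu ep; exists e.2, e.1, p; split=> //; apply: coords_hpart cu.
split=> //.
  by move=> e /L_elt[u [_ hu cu]]; exists u.
split; first split; first split => //.
- by move=> u [e [_ hu _]]; exists e.2.
- move=> v; split; last first.
    by apply: gen_sub => t [u /G_im imu hu]; apply: gen_in; exists u.
  apply: gen_sub => _ [u imu [z [c [i [hu cu ci ->]]]]].
  have [e [eL ez ei]] := L_full z c i (coords_im_space imu cu) ci.
  have [g [_ hg cg]] := L_elt e eL.
  rewrite (_ : _ *: B' i = term (c i 0 / e.1 i 0) (z - e.2) *:
      (term (e.1 i 0) (e.2 - gr' i) *: B' i)); last first.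
    rewrite scalerA termM ?legr_sub ?(pivot_supported cg ei) //.
    by rewrite divfK ?ei.1 // addrA subrK.
  by apply/genZ/gen_in; exists g; [exists e|apply: LT_elt].
move=> G' G'G [_ LTG'] u Gu; have [e [eL hu cu]] := Gu.
have [_ [p ep]] := L_im e eL.
have LT_delta e' i u' : coords B' gr' e'.2 u' e'.1 -> pivot e'.1 i ->
    coords B' gr' e'.2 (term (e'.1 i 0) (e'.2 - gr' i) *: B' i)
      (e'.1 i 0 *: delta_mx i 0).
  by move=> cu' ei; apply: coords_term (pivot_supported cu' ei) (coords_basis _ _ _).
have [l [hl El]] : LTgen B' gr' G' (term (e.1 p 0) (e.2 - gr' p) *: B' p).
  by apply/LTG'/gen_in; exists u; [apply: G_im|apply: LT_elt].
pose P (q : {mpoly K[2]} * F') (x : ('cV[K]_m * grade) * 'I_m) :=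
  exists u', [/\ G' u', x.1 \in L, coords B' gr' x.1.2 u' x.1.1, pivot x.1.1 x.2
    & q.2 = term (x.1.1 x.2 0) (x.1.2 - gr' x.2) *: B' x.2].
have [f hf] : exists f, forall q, q \in l -> P q (f q).
  apply: (seq_choice (e, p)) => q /hl[u' G'u' [z [c [i [hz cz ci Eq]]]]].
  have [e' [e'L he' ce']] := G'G _ G'u'.
  have u'0 : u' <> 0.
    move=> u'0; rewrite u'0 in cz; have := pivot_neq0 ci.
    by rewrite (uniqB' cz (coords0 B' gr' z)) eqxx.
  have Ez := hpart_grade_unique u'0 hz he'; rewrite Ez in cz Eq.
  have Ec := uniqB' cz ce'; rewrite Ec in ci Eq.
  by exists (e', i), u'.
have hq q : q \in l -> hpart (f q).1.2 q.2.
  move=> ql; have [u' [_ _ cu' pu' ->]] := hf q ql.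
  exact: coords_hpart (LT_delta _ _ _ cu' pu').
have ht : hpart e.2 (term (e.1 p 0) (e.2 - gr' p) *: B' p).
  exact: coords_hpart (LT_delta _ _ _ cu ep).
have Et := homogeneous_comb hq ht El.
set a := fun q => _ in Et.
have ct : coords B' gr' e.2 (term (e.1 p 0) (e.2 - gr' p) *: B' p)
    (\sum_(q <- l | legr (f q).1.2 e.2)
        q.1@_(expo (e.2 - (f q).1.2)) *: ((f q).1.1 (f q).2 0 *: delta_mx (f q).2 0)).
  rewrite Et; apply: coords_sum => q ql le; apply: coords_term => //.
  by have [u' [_ _ cu' pu' ->]] := hf q ql; apply: LT_delta cu' pu'.
have /(congr1 (fun c : 'cV[K]_m => c p 0)) := uniqB' ct (LT_delta _ _ _ cu ep).
case: (boolP (has (fun q => legr (f q).1.2 e.2 && (p == (f q).2)) l)).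
  case/hasP => q ql /andP[le /eqP Ep] _.
  have [u' [G'u' e'L cu' pu' _]] := hf q ql; rewrite -Ep in pu'.
  have Ee := L_anti _ _ _ e'L eL pu' ep le; rewrite Ee in cu'.
  by rewrite (coords_inj cu cu').
move/hasPn => hno; rewrite summxE big1_seq => [|q /andP[le ql]].
  by rewrite !mxE !eqxx mulr1 => /esym/eqP; rewrite (negPf ep.1).
by have := hno q ql; rewrite le !mxE /= => /negPf ->; rewrite !mulr0.
Qed.

End Image.
(** * Reduction of the columns *)

Section Reduction.
Variables (K : fieldType) (m n : nat) (A : 'M[K]_(m, n)) (lab : 'I_n -> grade).
Implicit Types (M : 'M[K]_(m, n)) (D : {set 'I_n}) (pj em : 'I_m -> option 'I_n).
Implicit Types (j k cur : 'I_n) (p : 'I_m) (y : int).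

Local Notation xl j := (lab j).1.
Local Notation yl j := (lab j).2.

Definition filt M D y : {vspace 'cV[K]_m} :=
  (\sum_(j | (j \in D) && (yl j <= y)%R) <[col j M]>)%VS.

Definition addcol M cur k (q : K) : 'M[K]_(m, n) :=
  \matrix_(i, j) (M i j - (if j == cur then q * M i k else 0)).

Lemma col_addcol M cur k q j :
  col j (addcol M cur k q) = col j M - (if j == cur then q *: col k M else 0).
Proof. by apply/colP => i; rewrite !mxE; case: eqP; rewrite !mxE. Qed.

Lemma addcolK M cur k q : k != cur -> addcol (addcol M cur k q) cur k (- q) = M.
Proof.
move=> /negPf kc; apply/matrixP => i j; rewrite !mxE kc subr0.
by case: eqP => _; rewrite ?subr0 // mulNr opprK subrK.
Qed.

(** Subtracting a multiple of a column from one of larger or equal [y] is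
    invisible to the spans of the columns up to each [y]. *)
Lemma filt_addcol M D cur k q y : k != cur -> k \in D -> yl k <= yl cur ->
  filt (addcol M cur k q) D y = filt M D y.
Proof.
move=> kc kD ky.
have sub N a : (filt (addcol N cur k a) D y <= filt N D y)%VS.
  apply/subv_sumP => j /andP[jD jy]; rewrite -memvE col_addcol.
  have mem i : i \in D -> yl i <= y -> col i N \in filt N D y.
    by move=> iD iy; rewrite memvE; apply: (sumv_sup i) => //; apply/andP.
  apply: rpredB; first exact: mem.
  case: eqP => [ej|_]; last exact: rpred0.
  by apply: rpredZ; apply: mem => //; apply: le_trans ky _; rewrite -ej.
apply/eqP; rewrite eqEsubv sub /=.
by rewrite -{1}(addcolK M q kc) sub.
Qed.

Lemma col_in_filt M D j : j \in D -> col j M \in filt M D (yl j).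
Proof. by move=> jD; rewrite memvE; apply: (sumv_sup j); rewrite ?jD ?lexx. Qed.

(** [pj p] is the column holding pivot [p], and [D] are the columns processed so
    far.  The column [c], if any, is the one being reduced: it is the only one
    that may be nonzero without holding a pivot. *)
Record reducing M D pj (c : option 'I_n) : Prop := Reducing {
  red_slot : forall p j, pj p = Some j ->
    [/\ j \in D, Some j <> c & pivot (col j M) p];
  red_cover : forall j, j \in D ->
    [\/ Some j = c, col j M = 0 | exists p, pj p = Some j];
  red_span : forall y, filt M D y = filt A D y;
  red_rest : forall j, j \notin D -> col j M = col j A }.

Definition carrying M D pj cur (b : nat) : Prop :=
  [/\ reducing M D pj (Some cur), cur \in D
    & forall p, (b <= p)%N -> M p cur = 0].

Definition set_slot pj p j : 'I_m -> option 'I_n :=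
  fun p' => if p' == p then Some j else pj p'.

(** How the holders of the pivots may evolve. *)
Definition sinks pj pj' : Prop := forall p j, pj p = Some j ->
  exists2 j', pj' p = Some j' & j' = j \/ yl j' < yl j.

Lemma sinks_refl pj : sinks pj pj.
Proof. by move=> p j h; exists j; [|left]. Qed.

Lemma sinks_trans pj1 pj2 pj3 : sinks pj1 pj2 -> sinks pj2 pj3 -> sinks pj1 pj3.
Proof.
move=> h12 h23 p j /h12[k /h23[l hl lk] kj]; exists l => //.
case: lk kj => [->//|lk] [<-|kj]; right=> //; exact: lt_trans kj.
Qed.

Lemma reducing_slot_inj M D pj c p p' j :
  reducing M D pj c -> pj p = Some j -> pj p' = Some j -> p = p'.
Proof.
by move=> h /(red_slot h)[_ _ pp] /(red_slot h)[_ _ pp']; apply: pivot_unique pp pp'.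
Qed.

(** A column holds at most one pivot, as it has only one. *)
Lemma card_slots M D pj c :
  reducing M D pj c -> (#|[set p | isSome (pj p)]| <= minn m n)%N.
Proof.
move=> h; rewrite leq_min; apply/andP; split.
  by rewrite -[X in (_ <= X)%N](card_ord m) max_card.
rewrite -(@card_in_imset _ _ pj) => [|p p']; last first.
  rewrite !inE; case E: (pj p) => [j|] // _; case E': (pj p') => [j'|] // _ [jj'].
  by rewrite -jj' in E'; apply: reducing_slot_inj h E E'.
have sub : pj @: [set p | isSome (pj p)] \subset [set~ None].
  by apply/subsetP => _ /imsetP[p hp ->]; move: hp; rewrite !inE; case: (pj p).
apply: leq_trans (subset_leq_card sub) _.
by rewrite cardsC1 card_option card_ord.
Qed.

Lemma carrying_start M D pj b : reducing M D pj None -> b \notin D ->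
  carrying M (b |: D) pj b m.
Proof.
move=> h bD; have colb := red_rest h bD.
split; last 2 first.
- by rewrite setU11.
- by move=> p; rewrite leqNgt ltn_ord.
have filtE N y : filt N (b |: D) y =
    (filt N D y + (if (yl b <= y)%R then <[col b N]> else 0))%VS.
  rewrite /filt (bigID (mem D)) /=; congr (_ + _)%VS.
    by apply: eq_bigl => j; rewrite !inE; case: (j \in D); rewrite ?orbT ?andbF ?andbT.
  case: ifP => by_.
    rewrite (big_pred1 b) // => j; rewrite !inE /=; have [->|] := eqVneq j b.
      by rewrite by_ bD.
    by move=> _; case: (j \in D); rewrite ?andbF.
  rewrite big1 // => j; rewrite !inE; have [->|] := eqVneq j b; first by rewrite by_.
  by move=> _; case: (j \in D); rewrite ?andbF.
split.
- move=> p j /(red_slot h)[jD _ pj']; split=> //; first by rewrite !inE jD orbT.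
  by case=> jb; rewrite jb (negPf bD) in jD.
- move=> j; rewrite !inE => /orP[/eqP->|/(red_cover h)[//||]]; first exact: Or31.
    exact: Or32.
  exact: Or33.
- by move=> y; rewrite !filtE (red_span h) colb.
- by move=> j; rewrite !inE negb_or => /andP[_ /(red_rest h)].
Qed.

Lemma carrying_zero M D pj cur p :
  carrying M D pj cur p.+1 -> M p cur = 0 -> carrying M D pj cur p.
Proof.
move=> [h curD hz] z; split=> // r; rewrite leq_eqVlt => /orP[/eqP e|/hz//].
by rewrite (_ : r = p) //; apply: val_inj.
Qed.

Lemma carrying_end M D pj cur : carrying M D pj cur 0 -> reducing M D pj None.
Proof.
move=> [h curD hz]; split; [| |exact: red_span h|exact: red_rest h].
  by move=> p j /(red_slot h)[jD _ pv]; split=> // -[].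
move=> j /(red_cover h)[[->]|c0|c1]; [|exact: Or32|exact: Or33].
by apply: Or32; apply/colP => i; rewrite !mxE hz.
Qed.

Lemma carrying_pivot M D pj cur p :
  carrying M D pj cur p.+1 -> M p cur != 0 -> pivot (col cur M) p.
Proof. by move=> [_ _ hz] nz; split=> [|r pr]; rewrite mxE // hz. Qed.

Lemma carrying_place M D pj cur p : carrying M D pj cur p.+1 ->
  M p cur != 0 -> pj p = None -> reducing M D (set_slot pj p cur) None.
Proof.
move=> hc nz none; have pv := carrying_pivot hc nz; have [h curD hz] := hc.
split; [| |exact: red_span h|exact: red_rest h].
  move=> r j; rewrite /set_slot; case: eqP => [->[<-]|_ /(red_slot h)[jD _ pv']].
    by split=> // -[].
  by split=> // -[].
move=> j /(red_cover h)[[->]|c0|[r hr]]; [|exact: Or32|].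
  by apply: Or33; exists p; rewrite /set_slot eqxx.
apply: Or33; exists r; rewrite /set_slot; case: eqP => // e.
by rewrite e none in hr.
Qed.

Lemma sinks_place pj p cur : pj p = None -> sinks pj (set_slot pj p cur).
Proof.
move=> none r j hr; exists j; last by left.
by rewrite /set_slot; case: eqP hr => // ->; rewrite none.
Qed.

Lemma carrying_slot M D pj cur b p k : carrying M D pj cur b -> pj p = Some k ->
  [/\ k \in D, k != cur & pivot (col k M) p].
Proof.
move=> [h _ _] /(red_slot h)[kD kc pv]; split=> //.
by apply: contra_not_neq kc => ->.
Qed.

(** The column [cur] takes over the pivot, and the former holder, which vanishes
    below row [p] as well, is carried on in its place. *)
Lemma carrying_swap M D pj cur p k : carrying M D pj cur p.+1 ->
  M p cur != 0 -> pj p = Some k -> carrying M D (set_slot pj p cur) k p.+1.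
Proof.
move=> hc nz sk; have pv := carrying_pivot hc nz.
have [kD kc [_ pk]] := carrying_slot hc sk; have [h curD hz] := hc.
split=> //; last by move=> r /pk; rewrite mxE.
split; [| |exact: red_span h|exact: red_rest h].
  move=> r j; rewrite /set_slot; case: eqP => [->[<-]|rp hr].
    by split=> // -[e]; rewrite e eqxx in kc.
  have [jD _ pv'] := red_slot h hr; split=> // -[e]; apply: rp.
  by rewrite e in hr; apply: reducing_slot_inj h hr sk.
move=> j /(red_cover h)[[->]|c0|[r hr]]; [|exact: Or32|].
  by apply: Or33; exists p; rewrite /set_slot eqxx.
have [e|rp] := eqVneq r p.
  by apply: Or31; rewrite -sk -hr e.
by apply: Or33; exists r; rewrite /set_slot (negPf rp).
Qed.

Lemma sinks_swap pj p cur k :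
  pj p = Some k -> yl cur < yl k -> sinks pj (set_slot pj p cur).
Proof.
move=> sk lt r j hr; rewrite /set_slot; case: eqP => [e|_]; last by exists j; [|left].
by exists cur => //; right; rewrite e sk in hr; case: hr => <-.
Qed.

(** The holder of pivot [p] clears row [p] of the carried column and leaves the
    rows below it zero. *)
Lemma carrying_reduce M D pj cur p k : carrying M D pj cur p.+1 ->
  pj p = Some k -> yl k <= yl cur ->
  carrying (addcol M cur k (M p cur / M p k)) D pj cur p.
Proof.
move=> hc sk le; have [kD kc [kp pk]] := carrying_slot hc sk.
have [h curD hz] := hc; rewrite mxE in kp.
set M' := addcol _ _ _ _.
have colE j : j != cur -> col j M' = col j M.
  by move=> /negPf jc; rewrite col_addcol jc subr0.
split=> //; last first.
  move=> r; rewrite leq_eqVlt mxE eqxx => /orP[/eqP e|pr].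
    by rewrite (_ : r = p) ?divfK ?subrr //; apply: val_inj.
  by rewrite hz //; have := pk r pr; rewrite mxE => ->; rewrite mulr0 subrr.
split.
- move=> r j hr; have [jD jc pv] := red_slot h hr; split=> //.
  by rewrite colE //; apply: contra_not_neq jc => ->.
- move=> j jD; have [->|jc] := eqVneq j cur; first exact: Or31.
  by rewrite colE //; apply: red_cover h _ jD.
- by move=> y; rewrite filt_addcol // (red_span h).
- move=> j jD; rewrite colE ?(red_rest h) //.
  by apply: contraNneq jD => ->.
Qed.

(** The columns have distinct pivots, so no cancellation is possible at the
    largest pivot of the columns in a linear combination. *)
Lemma filt_pivot M D pj y w p : reducing M D pj None ->
  w \in filt M D y -> pivot w p -> exists2 j, pj p = Some j & yl j <= y.
Proof.
move=> h /memv_sum_lines[c Ew] pw.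
(* Rows that are the pivot of a column taking part in the combination. *)
pose hit q := if pj q is Some j then (yl j <= y) && (c j != 0) else false.
have colrow j : j \in D -> yl j <= y -> c j *: col j M != 0 ->
    exists2 q, pj q = Some j & hit q.
  rewrite scaler_eq0 negb_or => jD jy /andP[cj colj].
  have [//|e|[q' hq]] := red_cover h jD; first by rewrite e eqxx in colj.
  by exists q' => //; rewrite /hit hq jy.
have [q0 hq0] : exists q, hit q.
  apply/existsP; apply: contraNT (pivot_neq0 pw) => /existsPn no.
  rewrite Ew big1 // => j /andP[jD jy]; apply/eqP/negPn/negP => nz.
  by have [q _ hq] := colrow j jD jy nz; have := no q; rewrite hq.
case: (@arg_maxnP _ q0 hit val hq0) => q hitq qmax.
have [j sj [jy cj]] : exists2 j, pj q = Some j & yl j <= y /\ c j != 0.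
  by move: hitq; rewrite /hit; case: (pj q) => // j /andP[]; exists j.
have [jD _ [pvj hij]] := red_slot h sj.
have pwq : pivot w q.
  split=> [|r qr]; rewrite Ew summxE.
    rewrite (bigD1 j) ?jD ?jy //= big1 => [|i /andP[/andP[iD iy] ij]].
      by rewrite addr0 mxE mulf_neq0.
    have [->|nz] := eqVneq (c i *: col i M) 0; first by rewrite mxE.
    have [q' sq' hq'] := colrow i iD iy nz.
    have [_ _ [_ hi]] := red_slot h sq'; rewrite mxE hi ?mulr0 //.
    rewrite ltn_neqAle; apply/andP; split; last exact: qmax.
    apply: contra_neqN ij => /eqP/val_inj e; rewrite e sj in sq'.
    by case: sq' => ->.
  rewrite big1 // => i /andP[iD iy].
  have [->|nz] := eqVneq (c i *: col i M) 0; first by rewrite mxE.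
  have [q' sq' hq'] := colrow i iD iy nz.
  have [_ _ [_ hi]] := red_slot h sq'; rewrite mxE hi ?mulr0 //.
  exact: leq_ltn_trans (qmax _ hq') qr.
by exists j => //; rewrite (pivot_unique pw pwq).
Qed.

End Reduction.
(** * Recording the elements of the Groebner basis *)

Section Log.
Variables (K : fieldType) (m n : nat) (A : 'M[K]_(m, n)) (lab : 'I_n -> grade).
Implicit Types (M : 'M[K]_(m, n)) (D : {set 'I_n}) (pj em : 'I_m -> option 'I_n).
Implicit Types (j c : 'I_n) (p : 'I_m) (e : 'cV[K]_m * grade).
Implicit Types (L : seq ('cV[K]_m * grade)).

Local Notation xl j := (lab j).1.
Local Notation yl j := (lab j).2.

(** [em p] is the column that held pivot [p] when [p] was last recorded. *)
Record logged L em : Prop := Logged {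
  log_uniq : uniq L;
  log_im : forall e, e \in L -> e.1 \in im_space A lab e.2 /\ exists p, pivot e.1 p;
  log_low : forall e p, e \in L -> pivot e.1 p ->
    exists2 j, em p = Some j & yl j <= e.2.2;
  log_has : forall p j, em p = Some j ->
    exists e, [/\ e \in L, pivot e.1 p & e.2.2 = yl j];
  log_anti : forall e1 e2 p, e1 \in L -> e2 \in L -> pivot e1.1 p -> pivot e2.1 p ->
    legr e1.2 e2.2 -> e1 = e2 }.

(** The pivots in all degrees that involve processed columns only come from
    recorded elements. *)
Definition complete D L : Prop := forall z w p, (forall j, xl j <= z.1 -> j \in D) ->
  w \in im_space A lab z -> pivot w p ->
  exists e, [/\ e \in L, legr e.2 z & pivot e.1 p].

(** The state between two columns: [D] is an initial part of the columns in the
    order of [x], and the first coordinates of the grades in [L] are among those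
    [x] all of whose columns are in [D]. *)
Record sweeping M D pj em L : Prop := Sweeping {
  sw_red : reducing A lab M D pj None;
  sw_sinks : sinks lab em pj;
  sw_log : logged L em;
  sw_order : forall j j', j \in D -> j' \notin D -> xl j <= xl j';
  sw_before : forall e j, e \in L -> j \notin D -> e.2.1 < xl j;
  sw_complete : complete D L }.

Lemma sweeping_start : sweeping A set0 (fun=> None) (fun=> None) [::].
Proof.
split=> //.
- by split=> // j; rewrite inE.
- by move=> j j'; rewrite inE.
move=> z w p h; suff -> : im_space A lab z = 0%VS.
  by rewrite memv0 => /eqP -> /pivot_neq0; rewrite eqxx.
by rewrite /im_space big1 // => j /andP[/h]; rewrite inE.
Qed.

(** The state once the column [c] has been inserted, while changed pivots are
    recorded at its [x]; the pivots before [b] have been dealt with. *)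
Record flushing M D pj c (b : nat) em L : Prop := Flushing {
  fl_red : reducing A lab M (c |: D) pj None;
  fl_sinks : sinks lab em pj;
  fl_log : logged L em;
  fl_order : forall j j', j \in c |: D -> j' \notin c |: D -> xl j <= xl j';
  fl_max : forall j, j \in c |: D -> xl j <= xl c;
  fl_new : c \notin D;
  fl_complete : complete D L;
  fl_done : forall p, (p < b)%N -> em p = pj p;
  fl_recent : forall e p, e \in L -> pivot e.1 p ->
    e.2.1 < xl c \/ e.2.1 = xl c /\ (p < b)%N }.

Lemma flushing_start M D pj em L c M' pj' : sweeping M D pj em L ->
  c \notin D -> (forall j, j \notin D -> xl c <= xl j) ->
  reducing A lab M' (c |: D) pj' None -> sinks lab pj pj' ->
  flushing M' D pj' c 0 em L.
Proof.
move=> h cD cmin hr hs; split=> //.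
- exact: sinks_trans (sw_sinks h) hs.
- exact: sw_log h.
- move=> j j'; rewrite !inE negb_or => /orP[/eqP->|jD] /andP[_ j'D]; first exact: cmin.
  exact: (sw_order h jD j'D).
- by move=> j; rewrite !inE => /orP[/eqP->|/(sw_order h)->].
- exact: sw_complete h.
- by move=> e p eL _; left; exact: (sw_before h eL cD).
Qed.

Lemma flushing_skip M D pj c p em L :
  flushing M D pj c p em L -> pj p = em p -> flushing M D pj c p.+1 em L.
Proof.
move=> h pe; case: (h) => *; split=> // [q|e q eL eq].
  rewrite ltnS leq_eqVlt => /orP[/eqP/val_inj->//|]; exact: (fl_done h).
by case: (fl_recent h eL eq) => [|[-> lt]]; [left|right; rewrite ltnS ltnW].
Qed.

(** The holder of [p] has changed since [p] was last recorded, if ever, and that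
    was at an earlier [x]; so its [y] is smaller than all those recorded for [p]: the new grade is
    incomparable to them. *)
Lemma flushing_emit M D pj c p j em L :
  flushing M D pj c p em L -> pj p = Some j -> em p <> Some j ->
  flushing M D pj c p.+1 (set_slot em p j) (rcons L (col j M, (xl c, yl j))).
Proof.
move=> h sj ne; have hl := fl_log h.
have [jD _ pv] := red_slot (fl_red h) sj; set e0 := (col j M, _).
(* Compared to the older elements with the same pivot, [x] grows and [y] drops. *)
have e0_new e : e \in L -> pivot e.1 p -> e.2.1 < xl c /\ yl j < e.2.2.
  move=> eL ep; have [//|[_]] := fl_recent h eL ep; last by rewrite ltnn.
  split=> //; have [j' ej' le] := log_low hl eL ep.
  have [j'' e'' [jj|lt]] := fl_sinks h ej'; rewrite sj in e''; case: e'' => e''.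
    by case: ne; rewrite ej' e'' jj.
  by rewrite e''; apply: lt_le_trans lt le.
have e0L : e0 \notin L.
  by apply/negP => eL; have [] := e0_new _ eL pv; rewrite ltxx.
have mem e : e \in rcons L e0 -> e = e0 \/ e \in L.
  by rewrite mem_rcons inE => /orP[/eqP|]; [left|right].
split; [exact: fl_red h| | |exact: fl_order h|exact: fl_max h|exact: fl_new h| | | ].
- move=> q i; rewrite /set_slot; case: eqP => [->[<-]|_ /(fl_sinks h)//].
  by exists j => //; left.
- split.
  + by rewrite rcons_uniq e0L (log_uniq hl).
  + move=> e /mem[->|/(log_im hl)//]; split; last by exists p.
    have := col_in_filt lab M jD; rewrite (red_span (fl_red h)); apply: subvP.
    apply/subv_sumP => i /andP[iD iy]; apply: (sumv_sup i) => //.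
    by rewrite /legr iy (fl_max h).
  + move=> e q /mem[->|eL] eq; rewrite /set_slot.
      by rewrite (pivot_unique eq pv) eqxx; exists j.
    case: eqP eq => [-> eq|_ eq]; last first.
      exact: (log_low hl eL eq).
    by exists j => //; have [_ /ltW] := e0_new _ eL eq.
  + move=> q i; rewrite /set_slot; case: eqP => [-> [<-]|_ /(log_has hl)[e [eL eq Ey]]].
      by exists e0; rewrite mem_rcons mem_head.
    by exists e; rewrite mem_rcons inE eL orbT.
  + move=> e1 e2 q /mem[->|e1L] /mem[->|e2L] p1 p2 //; last exact: (log_anti hl e1L e2L p1 p2).
      rewrite -(pivot_unique pv p1) in p2; have [lt _] := e0_new _ e2L p2.
      by case/andP => /=; rewrite leNgt lt.
    rewrite -(pivot_unique pv p2) in p1; have [_ lt] := e0_new _ e1L p1.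
    by case/andP => _ /=; rewrite leNgt lt.
- move=> z w q hz wz pq; have [e [eL ez ep]] := fl_complete h hz wz pq.
  by exists e; rewrite mem_rcons inE eL orbT.
- move=> q; rewrite ltnS leq_eqVlt /set_slot => /orP[/eqP/val_inj->|lt].
    by rewrite eqxx.
  by case: eqP => [->//|_]; exact: (fl_done h lt).
move=> e q /mem[->|eL] eq; first by right; rewrite (pivot_unique eq pv).
by case: (fl_recent h eL eq) => [|[-> lt]]; [left|right; rewrite ltnS ltnW].
Qed.

(** For degrees [z] with [z.1] at least the finished [x], and below that of the
    other columns, the image is spanned by the processed columns up to [z.2], and
    every pivot has just been recorded with its holder. *)
Lemma flushing_end M D pj c em L : flushing M D pj c m em L ->
  (forall j, j \notin c |: D -> xl c < xl j) -> sweeping M (c |: D) pj em L.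
Proof.
move=> h hc; have emE p : em p = pj p by apply: (fl_done h).
have Lx e : e \in L -> e.2.1 <= xl c.
  move=> eL; have [_ [p ep]] := log_im (fl_log h) eL.
  by case: (fl_recent h eL ep) => [/ltW//|[->]].
split; [exact: fl_red h|exact: fl_sinks h|exact: fl_log h|exact: fl_order h| |].
  by move=> e j eL jD; apply: le_lt_trans (Lx e eL) (hc j jD).
move=> z w p hz wz pw; case: (lerP (xl c) z.1) => cz; last first.
  apply: (fl_complete h _ wz pw) => j jz; have := hz j jz; rewrite !inE.
  by case: eqP => // e; rewrite -e ltNge jz in cz.
have wf : w \in filt lab M (c |: D) z.2.
  rewrite (red_span (fl_red h)); move: wz; apply: subvP.
  apply/subv_sumP => j /andP[jx jy]; apply: (sumv_sup j) => //.
  by rewrite hz //; apply: jy.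
have [j sj jz] := filt_pivot (fl_red h) wf pw.
rewrite -emE in sj; have [e [eL ep Ey]] := log_has (fl_log h) sj.
by exists e; split=> //; rewrite /legr Ey jz (le_trans (Lx e eL) cz).
Qed.

(** While a column [b] with the [x] of [c] is missing, a degree whose columns are
    all processed cannot involve [c], so no new degree has to be covered. *)
Lemma sweeping_same_x M D pj em L c b : flushing M D pj c 0 em L ->
  (forall e j, e \in L -> j \notin D -> e.2.1 < xl j) ->
  b \notin c |: D -> xl b <= xl c -> sweeping M (c |: D) pj em L.
Proof.
move=> h hL bD bc.
split; [exact: fl_red h|exact: fl_sinks h|exact: fl_log h|exact: fl_order h| |].
  by move=> e j eL; rewrite !inE negb_or => /andP[_ jD]; apply: hL.
move=> z w p hz wz pw; apply: (fl_complete h _ wz pw) => j jz.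
have := hz j jz; rewrite !inE; case: eqP => // e _.
by case/negP: bD; apply: hz; apply: le_trans bc _; rewrite -e.
Qed.

End Log.
(** * Reasoning about programs and their running time *)

Section Wp.
Variables (K : fieldType) (S : nat).
Implicit Types (st s : store K) (c : cmd) (T : nat) (Q R : store K -> Prop).

(** Total correctness within time [T]. *)
Definition wp c st T Q : Prop :=
  exists st' t, [/\ exec S c st st' t, (t <= T)%N & Q st'].

(** The arrays of each kind that a command may write to; all others keep their
    contents ([exec_framed]), which spares the specifications below from listing
    what does not change. *)
Fixpoint iwr c : seq nat :=
  match c with
  | ISet x _ _ => [:: x]
  | Seq c1 c2 | If _ c1 c2 => iwr c1 ++ iwr c2
  | While _ c => iwr c
  | _ => [::]
  end.

Fixpoint fwr c : seq nat :=
  match c with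
  | FSet x _ _ => [:: x]
  | Seq c1 c2 | If _ c1 c2 => fwr c1 ++ fwr c2
  | While _ c => fwr c
  | _ => [::]
  end.

Fixpoint lwr c : seq nat :=
  match c with
  | LCopy x _ _ _ => [:: x]
  | Seq c1 c2 | If _ c1 c2 => lwr c1 ++ lwr c2
  | While _ c => lwr c
  | _ => [::]
  end.

Record framed c st st' : Prop := Framed {
  fr_i : forall x, x \notin iwr c -> forall a, ival st' x a = ival st x a;
  fr_f : forall x, x \notin fwr c -> forall a, fval st' x a = fval st x a;
  fr_l : forall x, x \notin lwr c -> forall a, lval st' x a = lval st x a }.

Lemma framed_refl c st : framed c st st.
Proof. by []. Qed.

Lemma framed_trans c1 c2 c st1 st2 st3 :
  {subset iwr c1 <= iwr c} -> {subset fwr c1 <= fwr c} -> {subset lwr c1 <= lwr c} ->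
  {subset iwr c2 <= iwr c} -> {subset fwr c2 <= fwr c} -> {subset lwr c2 <= lwr c} ->
  framed c1 st1 st2 -> framed c2 st2 st3 -> framed c st1 st3.
Proof.
move=> i1 f1 l1 i2 f2 l2 h1 h2; split=> x hx a.
- by rewrite (fr_i h2) ?(fr_i h1) //; apply: contra hx; [apply: i1|apply: i2].
- by rewrite (fr_f h2) ?(fr_f h1) //; apply: contra hx; [apply: f1|apply: f2].
- by rewrite (fr_l h2) ?(fr_l h1) //; apply: contra hx; [apply: l1|apply: l2].
Qed.

Lemma exec_framed c st st' t : exec S c st st' t -> framed c st st'.
Proof.
elim=> {c st st' t} //.
- by move=> st x a e _ _ _; split=> //= y; rewrite inE /upd => /negPf ->.
- by move=> st x a e _ _ _; split=> //= y; rewrite inE /upd => /negPf ->.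
- by move=> st x a y b _ _ _ _; split=> //= z; rewrite inE /upd => /negPf ->.
- move=> st st1 st2 c1 c2 t1 t2 _ h1 _ h2.
  by apply: framed_trans h1 h2 => x xc /=; rewrite mem_cat xc ?orbT.
- move=> st st1 b c1 c2 t _ _ _ h.
  by apply: framed_trans (framed_refl c1 st) h => x xc /=; rewrite mem_cat xc.
- move=> st st1 b c1 c2 t _ _ _ h.
  by apply: framed_trans (framed_refl c2 st) h => x xc /=; rewrite mem_cat xc orbT.
- by move=> st st1 st2 b c t1 t2 _ _ _ h1 _ h2; apply: framed_trans h1 h2.
Qed.

Lemma wp_use c st T Q R :
  wp c st T Q -> (forall s, framed c st s -> Q s -> R s) -> wp c st T R.
Proof.
move=> [s [t [ex le q]]] h; exists s, t; split=> //.
by apply: h q; apply: exec_framed ex.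
Qed.

Lemma wp_le c st T T' Q : wp c st T Q -> (T <= T')%N -> wp c st T' Q.
Proof.
by move=> [s [t [ex le q]]] h; exists s, t; split=> //; apply: leq_trans h.
Qed.

Lemma wp_skip st Q : Q st -> wp Skip st 1 Q.
Proof. by move=> q; exists st, 1%N; split=> //; constructor. Qed.

Lemma wp_iset st x a e Q :
  ifits st S a -> ifits st S e -> (ieval st a < S)%N ->
  Q (Store (upd (ival st) x (ieval st a) (ieval st e)) (fval st) (lval st)) ->
  wp (ISet x a e) st (icost a + icost e).+1 Q.
Proof. by move=> *; do 2 eexists; split; [constructor|by []|]. Qed.

Lemma wp_fset st x a e Q :
  ifits st S a -> ffits st S e -> (ieval st a < S)%N ->
  Q (Store (ival st) (upd (fval st) x (ieval st a) (feval st e)) (lval st)) ->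
  wp (FSet x a e) st (icost a + fcost e).+1 Q.
Proof. by move=> *; do 2 eexists; split; [constructor|by []|]. Qed.

Lemma wp_lcopy st x a y b Q :
  ifits st S a -> ifits st S b -> (ieval st a < S)%N -> (ieval st b < S)%N ->
  Q (Store (ival st) (fval st)
       (upd (lval st) x (ieval st a) (lval st y (ieval st b)))) ->
  wp (LCopy x a y b) st (icost a + icost b).+1 Q.
Proof. by move=> *; do 2 eexists; split; [constructor|by []|]. Qed.

Lemma wp_seq c1 c2 st T1 T2 Q :
  wp c1 st T1 (fun s => wp c2 s T2 Q) -> wp (Seq c1 c2) st (T1 + T2).+1 Q.
Proof.
move=> [s1 [t1 [ex1 le1 [s2 [t2 [ex2 le2 q]]]]]].
exists s2, (t1 + t2).+1; split=> //; first exact: ExSeq ex1 ex2.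
by rewrite ltnS leq_add.
Qed.

Lemma wp_ifT b c1 c2 st T Q : bfits st S b -> beval st b -> wp c1 st T Q ->
  wp (If b c1 c2) st (bcost b + T).+1 Q.
Proof.
move=> fb hb [s [t [ex le q]]]; exists s, (bcost b + t).+1.
by split=> //; [apply: ExIfT|rewrite ltnS leq_add2l].
Qed.

Lemma wp_ifF b c1 c2 st T Q : bfits st S b -> ~~ beval st b -> wp c2 st T Q ->
  wp (If b c1 c2) st (bcost b + T).+1 Q.
Proof.
move=> fb hb [s [t [ex le q]]]; exists s, (bcost b + t).+1.
by split=> //; [apply: ExIfF|rewrite ltnS leq_add2l].
Qed.

Lemma wp_if b c1 c2 st T1 T2 Q : bfits st S b ->
  (beval st b -> wp c1 st T1 Q) -> (~~ beval st b -> wp c2 st T2 Q) ->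
  wp (If b c1 c2) st (bcost b + (T1 + T2)).+1 Q.
Proof.
move=> fb h1 h2; case: (boolP (beval st b)) => hb.
  by apply: wp_le (wp_ifT c2 fb hb (h1 hb)) _; lia.
by apply: wp_le (wp_ifF c1 fb hb (h2 hb)) _; lia.
Qed.

(** [Inv T s] bounds by [T] the time that the loop still takes from [s]; the
    bound is what makes the loop terminate. *)
Lemma wp_while (Inv : nat -> store K -> Prop) b c st T Q :
  (forall T s, framed c st s -> Inv T s -> bfits s S b /\
     if beval s b then exists T1 T2,
       wp c s T1 (Inv T2) /\ ((bcost b + T1 + T2).+1 <= T)%N
     else ((bcost b).+1 <= T)%N /\ Q s) ->
  Inv T st -> wp (While b c) st T Q.
Proof.
move=> step; have := framed_refl c st; move: {2 3 4}st => s.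
elim/ltn_ind: T s => T IH s fr inv.
have [fb] := step T s fr inv; case: ifP => hb; last first.
  move=> [le q]; exists s, (bcost b).+1; split=> //.
  by apply: ExWhileF => //; rewrite hb.
move=> [T1 [T2 [[s1 [t1 [ex1 le1 inv1]]] le]]].
have fr1 : framed c st s1 by apply: framed_trans fr (exec_framed ex1).
have [|s2 [t2 [ex2 le2 q]]] := IH T2 _ s1 fr1 inv1.
  by apply: leq_trans le; rewrite ltnS leq_addl.
exists s2, (bcost b + t1 + t2).+1; split=> //; first exact: ExWhileT ex1 ex2.
by apply: leq_trans le; rewrite ltnS leq_add // leq_add2l.
Qed.

Definition var x := IGet x (ICst 0).
Definition set_var x e := ISet x (ICst 0) e.

Definition for_ x y c := Seq (set_var x (ICst 0))
  (While (BLeI (IAdd (var x) (ICst 1)) (var y))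
     (Seq c (set_var x (IAdd (var x) (ICst 1))))).

Definition seti st x v := Store (upd (ival st) x 0 v) (fval st) (lval st).

(** Counting from 0 up to the value of [y] in the variable [x].  The time of the
    rounds may differ, so that rounds with little to do can be charged less. *)
Lemma wp_for (I : nat -> store K -> Prop) x y c N (Tb : nat -> nat) st :
  (0 < S)%N -> x != y -> x \notin iwr c -> y \notin iwr c -> ival st y 0 = N ->
  I 0 (seti st x 0) ->
  (forall k s, (k < N)%N -> framed (for_ x y c) st s -> ival s x 0 = k -> I k s ->
     wp c s (Tb k) (fun s' => I k.+1 (seti s' x k.+1))) ->
  wp (for_ x y c) st (\sum_(k < N) (Tb k + 15) + 12) (fun s => I N s).
Proof.
move=> S0 xy xc yc yN I0 step.
pose Inv T s := exists k, [/\ (k <= N)%N, ival s x 0 = k, ival s y 0 = N, I k s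
  & (\sum_(k <= i < N) (Tb i + 15) + 8 <= T)%N].
apply: (@wp_le _ _ (3 + (\sum_(0 <= k < N) (Tb k + 15) + 8)).+1); last first.
  by rewrite big_mkord; lia.
apply: wp_seq; apply: wp_iset => //=.
apply: (@wp_while Inv); last first.
  exists 0%N; split=> //=; first by rewrite /upd !eqxx.
  by rewrite /upd eq_sym (negPf xy).
move=> T s fr [k [kN xk yk Ik le]]; split; first by rewrite /= S0.
rewrite /= xk yk addn1; case: ifP => lt; last first.
  by split; [lia|rewrite (_ : N = k) //; lia].
exists (Tb k + 6).+1, (\sum_(k.+1 <= i < N) (Tb i + 15) + 8)%N; split; last first.
  by move: le; rewrite big_ltn //; lia.
have frst : framed (for_ x y c) st s.
  apply: (@framed_trans (set_var x (ICst 0)) _ (for_ x y c)) _ fr => [a|a|a|a|a|a|] //=.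
  - by rewrite inE => /eqP ->; rewrite mem_head.
  - by rewrite inE mem_cat => ->; rewrite orbT.
  by split=> //= z; rewrite inE /upd => /negPf ->.
apply: wp_seq; apply: wp_use (step k s lt frst xk Ik) _ => s' fr' Ik'.
apply: wp_iset => //=; first by rewrite S0.
exists k.+1; rewrite (fr_i fr' xc) xk addn1; split=> //=; first by rewrite /upd !eqxx.
by rewrite /upd eq_sym (negPf xy) /= (fr_i fr' yc).
Qed.

End Wp.
(** * The program *)

Lemma wp_for_const (K : fieldType) (S : nat) (I : nat -> store K -> Prop) x y c N T st :
  (0 < S)%N -> x != y -> x \notin iwr c -> y \notin iwr c -> ival st y 0 = N ->
  I 0%N (seti st x 0) ->
  (forall k s, (k < N)%N -> framed (for_ x y c) st s -> ival s x 0 = k -> I k s ->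
     wp S c s T (fun s' => I k.+1 (seti s' x k.+1))) ->
  wp S (for_ x y c) st (N * (T + 15) + 12)%N (fun s => I N s).
Proof.
move=> S0 xy xc yc yN I0 step.
apply: wp_le (wp_for (Tb := fun=> T) S0 xy xc yc yN I0 step) _.
by rewrite sum_nat_const card_ord.
Qed.

(* The index arrays.  [Off] has the addresses of the columns in field array 0,
   since indices cannot be multiplied.  [Slot] has the columns holding the pivots
   now, [Emit] those that held them when they were last recorded; both are shifted
   by one, and 0 stands for no column.  [OutOff] is the first free address of
   field array 1. *)
Local Notation Rows := 0%N (only parsing).
Local Notation Cols := 1%N (only parsing).
Local Notation Count := 2%N (only parsing).
Local Notation Off := 3%N (only parsing).
Local Notation Slot := 4%N (only parsing).
Local Notation Emit := 5%N (only parsing).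
Local Notation Done := 6%N (only parsing).
Local Notation Best := 7%N (only parsing).
Local Notation New := 8%N (only parsing).
Local Notation Cur := 9%N (only parsing).
Local Notation Row := 10%N (only parsing).
Local Notation Other := 11%N (only parsing).
Local Notation Cnt := 12%N (only parsing).
Local Notation OutOff := 13%N (only parsing).
Local Notation Iter := 14%N (only parsing).
Local Notation Tmp := 15%N (only parsing).

Definition incr x := IAdd (var x) (ICst 1).
Definition decr x := ISub (var x) (ICst 1).

(** The address in field array 0 of the entry whose column and row numbers are in
    the scalars [x] and [r]. *)
Definition cell x r := IAdd (IGet Off (var x)) (var r).

(** An unprocessed column with the least first coordinate; [n] if none is left. *)
Definition find_best :=
  Seq (set_var Best (var Cols))
    (for_ Cnt Cols
      (If (BAnd (BLeI (IGet Done (var Cnt)) (ICst 0))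
             (BNot (BAnd (BLeI (incr Best) (var Cols)) (BLeL 0 (var Best) 0 (var Cnt)))))
        (set_var Best (var Cnt)) Skip)).

Definition sub_col :=
  Seq (FSet 2 (ICst 0) (FMul (FGet 0 (cell Cur Row)) (FInv (FGet 0 (cell Other Row)))))
    (for_ Cnt Rows
      (FSet 0 (cell Cur Cnt)
         (FSub (FGet 0 (cell Cur Cnt))
            (FMul (FGet 2 (ICst 0)) (FGet 0 (cell Other Cnt)))))).

(** Only column numbers are exchanged, so this takes constant time. *)
Definition swap_cols :=
  Seq (ISet Slot (var Row) (incr Cur))
    (Seq (set_var Tmp (var Cur))
      (Seq (set_var Cur (var Other)) (set_var Other (var Tmp)))).

Definition place := Seq (ISet Slot (var Row) (incr Cur)) (set_var Row (ICst 0)).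

Definition eliminate :=
  Seq (set_var Other (ISub (IGet Slot (var Row)) (ICst 1)))
    (Seq (If (BLeL 1 (var Other) 1 (var Cur)) Skip swap_cols) sub_col).

Definition insert_step :=
  Seq (set_var Row (decr Row))
    (If (BEqF (FGet 0 (cell Cur Row)) FZero) Skip
      (If (BLeI (IGet Slot (var Row)) (ICst 0)) place eliminate)).

Definition insert :=
  Seq (set_var Cur (var New))
    (Seq (set_var Row (var Rows)) (While (BLeI (ICst 1) (var Row)) insert_step)).

Definition emit :=
  Seq (set_var Other (ISub (IGet Slot (var Row)) (ICst 1)))
   (Seq (for_ Cnt Rows
          (FSet 1 (IAdd (var OutOff) (var Cnt)) (FGet 0 (cell Other Cnt))))
   (Seq (LCopy 2 (var Count) 0 (var New))
   (Seq (LCopy 3 (var Count) 1 (var Other))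
   (Seq (set_var OutOff (IAdd (var OutOff) (var Rows)))
   (Seq (set_var Count (incr Count))
        (ISet Emit (var Row) (IGet Slot (var Row)))))))).

Definition flush :=
  for_ Row Rows
    (If (BAnd (BLeI (IGet Slot (var Row)) (IGet Emit (var Row)))
              (BLeI (IGet Emit (var Row)) (IGet Slot (var Row))))
       Skip emit).

(** Inserts the next column, and records the changed pivots if no unprocessed
    column has the same first coordinate. *)
Definition sweep_step :=
  Seq find_best
   (Seq (set_var New (var Best))
   (Seq insert
   (Seq (ISet Done (var New) (ICst 1))
   (Seq find_best
   (If (BAnd (BLeI (incr Best) (var Cols)) (BLeL 0 (var Best) 0 (var New)))
      Skip flush))))).

Definition init :=
  Seq (for_ Cnt Rows
        (Seq (ISet Slot (var Cnt) (ICst 0)) (ISet Emit (var Cnt) (ICst 0))))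
   (Seq (set_var Count (ICst 0))
   (Seq (set_var OutOff (ICst 0))
   (Seq (set_var Tmp (ICst 0))
        (for_ Cnt Cols
          (Seq (ISet Off (var Cnt) (var Tmp))
          (Seq (ISet Done (var Cnt) (ICst 0))
               (set_var Tmp (IAdd (var Tmp) (var Rows))))))))).

Definition groebner_program := Seq init (for_ Iter Cols sweep_step).

(** * Stores representing the state of the computation *)

Section Representation.
Variables (K : fieldType) (m n : nat) (lab : 'I_n -> grade).
Implicit Types (st s : store K) (c : cmd).

Definition code k (o : option 'I_k) : nat := if o is Some j then j.+1 else 0.

Record has_frame st : Prop := HasFrame {
  hf_rows : ival st Rows 0 = m;
  hf_cols : ival st Cols 0 = n;
  hf_off : forall j : 'I_n, ival st Off j = (j * m)%N;
  hf_x : forall j : 'I_n, lval st 0 j = (lab j).1;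
  hf_y : forall j : 'I_n, lval st 1 j = (lab j).2 }.

Definition has_slots x (pj : 'I_m -> option 'I_n) st : Prop :=
  forall p : 'I_m, ival st x p = code (pj p).

Definition has_done (D : {set 'I_n}) st : Prop :=
  forall j : 'I_n, ival st Done j = (j \in D).

Definition has_mat (M : 'M[K]_(m, n)) st : Prop :=
  forall (i : 'I_m) (j : 'I_n), fval st 0 (j * m + i) = M i j.

Lemma has_frame_framed c st s :
  [&& Rows \notin iwr c, Cols \notin iwr c, Off \notin iwr c,
      0%N \notin lwr c & 1%N \notin lwr c] ->
  framed c st s -> has_frame st -> has_frame s.
Proof.
case/and5P=> h1 h2 h3 h4 h5 fr h; split=> [||j|j|j].
- by rewrite (fr_i fr h1) (hf_rows h).
- by rewrite (fr_i fr h2) (hf_cols h).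
- by rewrite (fr_i fr h3) (hf_off h).
- by rewrite (fr_l fr h4) (hf_x h).
- by rewrite (fr_l fr h5) (hf_y h).
Qed.

Lemma has_slots_framed c st s x pj : x \notin iwr c ->
  framed c st s -> has_slots x pj st -> has_slots x pj s.
Proof. by move=> h fr hx p; rewrite (fr_i fr h). Qed.

Lemma has_done_framed c st s D : Done \notin iwr c ->
  framed c st s -> has_done D st -> has_done D s.
Proof. by move=> h fr hx j; rewrite (fr_i fr h). Qed.

Lemma has_mat_framed c st s M : 0%N \notin fwr c ->
  framed c st s -> has_mat M st -> has_mat M s.
Proof. by move=> h fr hx i j; rewrite (fr_f fr h). Qed.

Lemma cell_eq (j j' : nat) (i i' : 'I_m) :
  (j * m + i == j' * m + i')%N = (j == j') && (i == i').
Proof.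
have m0 : (0 < m)%N by apply: leq_ltn_trans (ltn_ord i).
apply/eqP/andP => [e|[/eqP-> /eqP->]//]; split; apply/eqP.
  have := congr1 (divn^~ m) e.
  by rewrite !divnMDl // !divn_small ?addn0.
apply: val_inj; have := congr1 (modn^~ m) e.
by rewrite !modnMDl !modn_small.
Qed.

Lemma cell_lt (j N : nat) (i : 'I_m) : (j < N)%N -> (j * m + i < N * m)%N.
Proof.
move=> jN; apply: (@leq_trans (j * m + m)); first by rewrite ltn_add2l.
by rewrite addnC -mulSn leq_mul2r jN orbT.
Qed.

End Representation.

(** * Correctness and cost of the program *)

Section Correctness.
Variables (K : fieldType) (m n : nat) (A : 'M[K]_(m, n)) (lab : 'I_n -> grade).
Variable S : nat.
Hypotheses (S_gt0 : (0 < S)%N) (S_rows : (m <= S)%N) (S_cols : (n < S)%N).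
Hypothesis (S_mat : (n * m <= S)%N).
Implicit Types (st s : store K) (M : 'M[K]_(m, n)) (D : {set 'I_n}).
Implicit Types (pj em : 'I_m -> option 'I_n).

Local Notation xl j := (lab j).1.
Local Notation yl j := (lab j).2.
Local Notation has_frame := (@has_frame K m n lab).

Let lt_row (i : 'I_m) : (i < S)%N.
Proof. exact: leq_trans (ltn_ord i) S_rows. Qed.

Let lt_col (j : 'I_n) : (j < S)%N.
Proof. exact: ltn_trans (ltn_ord j) S_cols. Qed.

Let lt_cell (j : 'I_n) (i : 'I_m) : (j * m + i < S)%N.
Proof. exact: leq_trans (cell_lt i (ltn_ord j)) S_mat. Qed.

Definition first_open D (b : nat) : Prop :=
  b = n /\ (forall j, j \in D) \/
  exists j : 'I_n, [/\ b = j, j \notin D & forall j', j' \notin D -> xl j <= xl j'].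

Lemma wp_find_best D st : has_frame st -> has_done D st ->
  wp S find_best st (n * 50 + 20)%N (fun s => first_open D (ival s Best 0)).
Proof.
move=> hf hd; apply: wp_le; [apply: wp_seq; apply: wp_iset => //|].
  pose I k s := ival s Best 0 = n /\ (forall j : 'I_n, (j < k)%N -> j \in D) \/
    exists j : 'I_n, [/\ ival s Best 0 = j, j \notin D
      & forall j' : 'I_n, (j' < k)%N -> j' \notin D -> xl j <= xl j'].
  apply: wp_use (@wp_for_const K S I Cnt Cols _ n 30 _ S_gt0 _ _ _ _ _ _) _ => //.
  - by rewrite /= /upd /= (hf_cols hf).
  - by left; rewrite /= /upd /= (hf_cols hf).
  - move=> k s kn fr sk Ik; pose k' := Ordinal kn.
    have upto (j : 'I_n) : (j < k.+1)%N -> j = k' \/ (j < k)%N.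
      by rewrite ltnS leq_eqVlt => /orP[/eqP e|]; [left; apply: val_inj|right].
    have hf' : has_frame s.
      apply: (has_frame_framed _ fr) => //.
      by case: hf => *; split=> //= j; rewrite /upd /=.
    have dk : ival s Done k = (k' \in D).
      by rewrite (fr_i fr) //= /upd /= -(hd k').
    have k'S := lt_col k'; have kS : (k < S)%N := k'S.
    have bS : (ival s Best 0 < S)%N by case: Ik => [[-> _]|[j [-> _ _]]].
    apply: wp_le; [apply: wp_if|].
    + by rewrite /= sk S_gt0 kS bS.
    + rewrite /= sk dk (hf_cols hf') => /andP[k'D hmin].
      have {}k'D : k' \notin D by move: k'D; case: (_ \in D).
      apply: wp_iset => //=; right; exists k'; rewrite /upd /= sk.
      split=> // j' /upto[->//|j'k j'D].
      case: Ik hmin => [[_ all]|[j [-> jD jmin]]].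
        by rewrite all in j'D.
      rewrite addn1 ltn_ord /= (hf_x hf') (hf_x hf' k') -ltNge => /ltW lt.
      exact: le_trans lt (jmin _ j'k j'D).
    + rewrite /= sk dk (hf_cols hf') => hmin.
      apply: wp_skip; rewrite /I /= /upd /=.
      case: Ik hmin => [[e all]|[j [e jD jmin]]]; rewrite e ?addn1.
        rewrite ltnn /= andbT => h; left; split=> // j /upto[->|/all//].
        by move: h; case: (_ \in D).
      rewrite ltn_ord /= (hf_x hf') (hf_x hf' k') => h; right; exists j; split=> // j' /upto[->|/jmin//] k'D.
      by move: h; rewrite (negPf k'D) negbK.
    by [].
  move=> s _ [[e all]|[j [e jD jmin]]]; [left|right]; first by split=> // j; apply: all.
  by exists j; split=> // j'; apply: jmin.
by rewrite /=; lia.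
Qed.

Lemma wp_sub_col M st (cur k : 'I_n) (p : 'I_m) :
  has_frame st -> has_mat M st -> ival st Cur 0 = cur -> ival st Other 0 = k ->
  ival st Row 0 = p -> k != cur ->
  wp S sub_col st (m * 40 + 40)%N (has_mat (addcol M cur k (M p cur / M p k))).
Proof.
move=> hf hM ecur ek ep kc; set q := _ / _.
apply: wp_le; [apply: wp_seq; apply: wp_fset => //|].
- by rewrite /= ep ecur ek !(hf_off hf) S_gt0 !lt_col !lt_cell.
- pose I (b : nat) s := forall (i : 'I_m) (j : 'I_n), fval s 0 (j * m + i) =
    M i j - (if (j == cur) && (i < b)%N then q * M i k else 0).
  apply: wp_use (@wp_for_const K S I Cnt Rows _ m 25 _ S_gt0 _ _ _ _ _ _) _ => //.
  + exact: (hf_rows hf).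
  + by move=> i j; rewrite /= /upd /= ltn0 andbF subr0 hM.
  + move=> b s bm fr sb Ib; pose b' := Ordinal bm.
    have e1 : ival s Cur 0 = cur by rewrite (fr_i fr) //= ecur.
    have e2 : ival s Other 0 = k by rewrite (fr_i fr) //= ek.
    have eo (j : 'I_n) : ival s Off j = (j * m)%N by rewrite (fr_i fr) //= (hf_off hf).
    have eq : fval s 2 0 = q.
      by rewrite (fr_f fr) //= /upd /= ep ecur ek !(hf_off hf) !hM.
    have addr (j : 'I_n) : (j * m + b)%N = (j * m + b')%N by [].
    apply: wp_fset; rewrite /= ?sb ?e1 ?e2 ?eo ?S_gt0 ?lt_col ?addr ?lt_cell //.
    move=> i j; rewrite /= /upd /= (cell_eq j cur i b') (Ib i j) (Ib b' cur) (Ib b' k) eq.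
    have -> : (i < b.+1)%N = (i == b') || (i < b)%N.
      by rewrite ltnS leq_eqVlt -val_eqE.
    rewrite ltnn andbF subr0 (negPf kc) /= subr0 val_eqE.
    have [->|_] //= := eqVneq j cur; have [->|_] //= := eqVneq i b'.
  by move=> s _ h i j; rewrite h mxE ltn_ord andbT.
by rewrite /=; lia.
Qed.

Definition occupied st (k : nat) : nat := (0 < ival st Slot k)%N.

Lemma sum_occupied M D pj st : has_slots Slot pj st -> reducing A lab M D pj None ->
  (\sum_(k < m) occupied st k <= minn m n)%N.
Proof.
move=> hs /card_slots; rewrite cardsE -sum1_card big_mkcond /=; apply: leq_trans.
by apply: leq_sum => p _; rewrite /occupied hs unfold_in; case: (pj p).
Qed.

(** The cost of dealing with one row, where [k] is 1 if its pivot is held and 0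
    otherwise: only held pivots cause work proportional to the column length. *)
Definition step_cost (k : nat) : nat := (m * 40 + 150) * k + 60.

(** The rows are charged according to the pivots held at the start: the only row
    whose pivot becomes held on the way is the one where the insertion stops. *)
Lemma wp_insert M D pj (b : 'I_n) st :
  has_frame st -> has_mat M st -> has_slots Slot pj st -> ival st New 0 = b ->
  b \notin D -> reducing A lab M D pj None ->
  wp S insert st (\sum_(k < m) step_cost (occupied st k) + 100)%N
    (fun s => exists M' pj', [/\ has_mat M' s, has_slots Slot pj' s,
       reducing A lab M' (b |: D) pj' None & sinks lab pj pj']).
Proof.
move=> hf hM hs eb bD hr.
(* Either a column is carried down to row [i], or it has found a free pivot. *)
pose Inv T s := (exists i M' pj' (cur : 'I_n),
    [/\ [/\ ival s Row 0 = i, (i <= m)%N & ival s Cur 0 = cur],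
       has_mat M' s, has_slots Slot pj' s,
       [/\ carrying A lab M' (b |: D) pj' cur i, sinks lab pj pj'
         & forall p : 'I_m, (p < i)%N -> pj' p = pj p]
     & (\sum_(k < i) step_cost (occupied st k) + 60 <= T)%N])
  \/ exists M' pj', [/\ ival s Row 0 = 0%N /\ (60 <= T)%N, has_mat M' s,
       has_slots Slot pj' s, reducing A lab M' (b |: D) pj' None & sinks lab pj pj'].
apply: wp_le; [apply: wp_seq; apply: wp_iset => //=|].
  apply: wp_seq; apply: wp_iset => //=.
  rewrite /upd /= eb (hf_rows hf).
  apply: (@wp_while _ _ Inv _ _ _ (\sum_(k < m) step_cost (occupied st k) + 60));
    last first.
    left; exists m, M, pj, b; split=> //=.
    split=> //; first exact: carrying_start.
    exact: sinks_refl.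
  move=> T s fr inv; split; first by rewrite /= S_gt0.
  have hf' : has_frame s.
    apply: (has_frame_framed _ fr) => //.
    by case: hf => *; split=> //= j; rewrite /upd /=.
  rewrite /=; case: inv => [[i [M' [pj' [cur [[ei im ecur] hM' hs' [hc hk hpj] le]]]]]|];
    last first.
    move=> [M' [pj' [[e0 le] hM' hs' hr' hk]]]; rewrite e0 /=; split; first by lia.
    by exists M', pj'.
  case: i => [|i] in ei im hc hpj le *; rewrite ei /=.
    split; first by move: le; rewrite big_ord0; lia.
    by exists M', pj'; split=> //; apply: carrying_end hc.
  pose p := Ordinal im; rewrite big_ord_recr /= in le.
  have lt_im : (i < S)%N := lt_row p.
  have loweri (q : 'I_m) : (q < i)%N -> (q < i.+1)%N by apply: ltnW.
  have addr (j : 'I_n) : (j * m + i < S)%N := lt_cell j p.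
  have eM (j : 'I_n) : fval s 0 (j * m + i) = M' p j := hM' p j.
  have es : ival s Slot i = code (pj' p) := hs' p.
  have eo : occupied st i = (pj p) :> nat by rewrite /occupied (hs p); case: (pj p).
  have hcp : carrying A lab M' (b |: D) pj' cur p.+1 := hc.
  have ppj : pj' p = pj p by apply: hpj => /=.
  set B := (\sum_(k < i) step_cost (occupied st k))%N in le.
  have c60 : (60 <= step_cost (occupied st i))%N by apply: leq_addl.
  case: (eqVneq (M' p cur) 0) => [z|nz].
    exists 50%N, (B + 60)%N; split; last by move: (c60) le; lia.
    apply: wp_le; [apply: wp_seq; apply: wp_iset => //=; first by rewrite S_gt0|].
      rewrite ei subn1 /=; apply: wp_ifT.
      + by rewrite /= /upd /= ecur (hf_off hf') S_gt0 lt_col addr.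
      + by rewrite /= /upd /= ecur (hf_off hf') eM z.
      apply: wp_skip; left; exists i, M', pj', cur; split=> //.
        by split=> //; apply: ltnW.
      split=> //; first exact: (carrying_zero hcp z).
      by move=> q /loweri/hpj.
    by [].
  case sp: (pj' p) => [k|]; last first.
    exists 50%N, 60%N; split; last by move: (c60) le; lia.
    apply: wp_le; [apply: wp_seq; apply: wp_iset => //=; first by rewrite S_gt0|].
      rewrite ei subn1 /=; apply: wp_ifF.
      + by rewrite /= /upd /= ecur (hf_off hf') S_gt0 lt_col addr.
      + by rewrite /= /upd /= ecur (hf_off hf') eM.
      apply: wp_ifT.
      + by rewrite /= /upd /= S_gt0 lt_im.
      + by rewrite /= /upd /= es sp.
      apply: wp_seq; apply: wp_iset; rewrite /= /upd /= ?S_gt0 ?lt_im //.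
      apply: wp_iset; rewrite /= /upd /= ?S_gt0 ?lt_im //.
      right; exists M', (set_slot pj' p cur); split=> //.
      + move=> q; rewrite /= /upd /= ecur addn1 /set_slot -val_eqE.
        by case: ifP => // _; apply: hs'.
      + exact: (carrying_place hcp nz sp).
      by apply: sinks_trans hk _; apply: sinks_place.
    by [].
  have [kD kc pk] := carrying_slot hc sp.
  exists (m * 40 + 130)%N, (B + 60)%N; split; last first.
    by move: le; rewrite {1}/step_cost eo -ppj sp /=; lia.
  apply: wp_le; [apply: wp_seq; apply: wp_iset => //=; first by rewrite S_gt0|].
    rewrite ei subn1 /=; apply: wp_ifF.
    + by rewrite /= /upd /= ecur (hf_off hf') S_gt0 lt_col addr.
    + by rewrite /= /upd /= ecur (hf_off hf') eM.
    apply: wp_ifF.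
    + by rewrite /= /upd /= S_gt0 lt_im.
    + by rewrite /= /upd /= es sp.
    apply: wp_seq; apply: wp_iset; rewrite /= /upd /= ?S_gt0 ?lt_im //.
    rewrite es sp /= subn1 /=.
    apply: wp_seq.
    (* After a possible exchange, [c1] is to be reduced by the holder [c2]. *)
    pose R s' := exists pj2 (c1 c2 : 'I_n), [/\ has_frame s', has_mat M' s',
      has_slots Slot pj2 s', [/\ ival s' Cur 0 = c1, ival s' Other 0 = c2 & ival s' Row 0 = i]
      & [/\ carrying A lab M' (b |: D) pj2 c1 i.+1, sinks lab pj pj2, pj2 p = Some c2,
          (yl c2 <= yl c1) & forall q : 'I_m, (q < i)%N -> pj2 q = pj' q]].
    apply: wp_use (_ : wp _ _ _ _ R) _.
      apply: wp_if.
      + by rewrite /= /upd /= S_gt0 ecur !lt_col.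
      + rewrite /= /upd /= ecur !(hf_y hf') => le_y.
        apply: wp_skip; exists pj', cur, k; split=> //=.
        by case: hf' => *; split=> //= j; rewrite /upd /=.
      rewrite /= /upd /= ecur !(hf_y hf') -ltNge => lt_y.
      apply: wp_seq; apply: wp_iset; rewrite /= /upd /= ?S_gt0 ?lt_im //.
      apply: wp_seq; apply: wp_iset; rewrite /= /upd /= ?S_gt0 ?lt_im //.
      apply: wp_seq; apply: wp_iset; rewrite /= /upd /= ?S_gt0 ?lt_im //.
      apply: wp_iset; rewrite /= /upd /= ?S_gt0 ?lt_im //.
      exists (set_slot pj' p cur), k, cur; split=> //=.
      + by case: hf' => *; split=> //= j; rewrite /upd /=.
      + move=> q; rewrite /= /upd /= ecur addn1 /set_slot -val_eqE.
        by case: ifP => // _; apply: hs'.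
      split; [exact: (carrying_swap hcp nz sp)| | |exact: ltW| ].
      + by apply: sinks_trans hk _; apply: sinks_swap sp lt_y.
      + by rewrite /set_slot eqxx.
      by move=> q qi; rewrite /set_slot -val_eqE /= (ltn_eqF qi).
    move=> s' _ [pj2 [c1 [c2 [hf2 hM2 hs2 [e1 e2 e3] [hc2 hk2 sp2 le2 low2]]]]].
    have [_ c21 _] := carrying_slot hc2 sp2.
    apply: wp_use (wp_sub_col hf2 hM2 e1 e2 (p := p) e3 c21) _ => s2 fr2 hM3.
    left; exists i, (addcol M' c1 c2 (M' p c1 / M' p c2)), pj2, c1; split=> //.
    + by split; [rewrite (fr_i fr2)|apply: ltnW|rewrite (fr_i fr2)].
    + exact: (has_slots_framed _ fr2).
    split=> //; first exact: (carrying_reduce (p := p) hc2 sp2 le2).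
    by move=> q qi; rewrite low2 //; apply/hpj/loweri.
  by rewrite /=; lia.
by rewrite /=; lia.
Qed.

Hypotheses (S_list : (n * minn m n <= S)%N) (S_out : (n * minn m n * m <= S)%N).

Lemma wp_emit M em (c j : 'I_n) (p : 'I_m) L st :
  has_frame st -> has_mat M st -> has_slots Emit em st ->
  ival st Slot p = j.+1 -> ival st Row 0 = p -> ival st New 0 = c ->
  output m st = L -> ival st OutOff 0 = (size L * m)%N -> (size L < n * minn m n)%N ->
  wp S emit st (m * 40 + 80)%N
    (fun s => [/\ has_slots Emit (set_slot em p j) s,
       output m s = rcons L (col j M, (xl c, yl j))
       & ival s OutOff 0 = ((size L).+1 * m)%N]).
Proof.
move=> hf hM he es ep ec eL eo sL.
have lt_out (i : 'I_m) : (size L * m + i < S)%N.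
  exact: leq_trans (cell_lt i sL) S_out.
have lt_list : (size L < S)%N by apply: leq_trans sL S_list.
have eN : ival st Count 0 = size L by rewrite -eL size_mkseq.
apply: wp_le; [apply: wp_seq; apply: wp_iset; rewrite /= ?ep ?S_gt0 ?lt_row //|].
  rewrite es subn1 /=; apply: wp_seq.
  pose I (b : nat) s := forall (l : nat) (i : 'I_m),
    ((l < size L)%N -> fval s 1 (l * m + i) = fval st 1 (l * m + i)) /\
    ((i < b)%N -> fval s 1 (size L * m + i) = M i j).
  apply: wp_use (@wp_for_const K S I Cnt Rows _ m 20 _ S_gt0 _ _ _ _ _ _) _ => //.
  - by rewrite /= /upd /= (hf_rows hf).
  - move=> b s bm fr sb Ib; pose b' := Ordinal bm.
    have e1 : ival s Other 0 = j by rewrite (fr_i fr) //= /upd.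
    have e2 : ival s OutOff 0 = (size L * m)%N by rewrite (fr_i fr) //= /upd /= eo.
    have e3 : ival s Off j = (j * m)%N by rewrite (fr_i fr) //= /upd /= (hf_off hf).
    have eM : fval s 0 (j * m + b) = M b' j by rewrite (fr_f fr) //=; apply: (hM b' j).
    have a1 : (size L * m + b < S)%N := lt_out b'.
    have a2 : (j * m + b < S)%N := lt_cell j b'.
    apply: wp_le; [apply: wp_fset; rewrite /= ?sb ?e1 ?e2 ?e3 ?S_gt0 ?lt_col //|by []].
    move=> l i; rewrite /= /upd /= (cell_eq l (size L) i b') eM; split=> [lt|].
      by rewrite (ltn_eqF lt) /=; apply: (Ib l i).1.
    rewrite (cell_eq (size L) (size L) i b') eqxx /=.
    have [->//|ib] := eqVneq i b'; rewrite ltnS leq_eqVlt => /orP[/eqP e|lt].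
      by case/eqP: ib; apply: val_inj.
    exact: (Ib l i).2.
  move=> s fr Is.
  have e1 : ival s Count 0 = size L by rewrite (fr_i fr) //= /upd /= eN.
  have e2 : ival s New 0 = c by rewrite (fr_i fr) //= /upd /= ec.
  have e3 : ival s Other 0 = j by rewrite (fr_i fr) //= /upd.
  have e4 : ival s OutOff 0 = (size L * m)%N by rewrite (fr_i fr) //= /upd /= eo.
  have e5 : ival s Rows 0 = m by rewrite (fr_i fr) //= /upd /= (hf_rows hf).
  have e6 : ival s Row 0 = p by rewrite (fr_i fr) //= /upd /= ep.
  have e7 : ival s Slot p = j.+1 by rewrite (fr_i fr) //= /upd /= es.
  apply: wp_seq; apply: wp_lcopy; rewrite /= ?e1 ?e2 ?S_gt0 ?lt_col //.
  apply: wp_seq; apply: wp_lcopy; rewrite /= ?e1 ?e3 ?S_gt0 ?lt_col //.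
  apply: wp_seq; apply: wp_iset; rewrite /= ?S_gt0 // e4 e5.
  apply: wp_seq; apply: wp_iset; rewrite /= ?S_gt0 // /upd /= e1.
  apply: wp_iset; rewrite /= /upd /= ?e6 ?S_gt0 ?lt_row //.
  split=> /=.
  - move=> q; rewrite /= /upd /= /set_slot -val_eqE e7; case: ifP => //= _.
    by rewrite (fr_i fr) //= /upd /= he.
  - rewrite /output /= /upd /= addn1 mkseqS; congr rcons; last first.
      congr pair; last by rewrite eqxx !(fr_l fr) //= (hf_x hf) (hf_y hf).
      by apply/colP => i; rewrite !mxE (Is 0%N i).2.
    rewrite -[RHS]eL /output eN; apply/eq_in_map => l; rewrite mem_iota /= => lt.
    rewrite (ltn_eqF lt) !(fr_l fr) //; congr pair.
    by apply/colP => i; rewrite !mxE (Is l i).1.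
  by rewrite /upd /= mulSn addnC.
by rewrite /=; lia.
Qed.

Lemma wp_flush M D pj (c : 'I_n) em L st :
  has_frame st -> has_mat M st -> has_slots Slot pj st -> has_slots Emit em st ->
  ival st New 0 = c -> output m st = L -> ival st OutOff 0 = (size L * m)%N ->
  flushing A lab M D pj c 0 em L ->
  (size L + \sum_(k < m) occupied st k <= n * minn m n)%N ->
  wp S flush st (\sum_(k < m) step_cost (occupied st k) + 20)%N
    (fun s => exists em' L', [/\ flushing A lab M D pj c m em' L',
       has_slots Emit em' s, output m s = L', ival s OutOff 0 = (size L' * m)%N
       & (size L' <= size L + \sum_(k < m) occupied st k)%N]).
Proof.
move=> hf hM hs he ec eL eo hfl hN.
pose I b s := exists em' L', [/\ flushing A lab M D pj c b em' L',
  has_slots Emit em' s, output m s = L', ival s OutOff 0 = (size L' * m)%N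
  & (size L' <= size L + \sum_(k < b) occupied st k)%N].
apply: wp_le (@wp_for K S I Row Rows _ m
  (fun k => (m * 40 + 100) * occupied st k + 25)%N st S_gt0 _ _ _ _ _ _) _ => //.
- exact: hf_rows hf.
- by exists em, L; split=> //; rewrite big_ord0 addn0.
- move=> b s bm fr sb [em' [L' [hfl' he' eL' eo' hN']]]; pose p := Ordinal bm.
  have hf' : has_frame s by apply: (has_frame_framed _ fr).
  have hM' : has_mat M s by apply: (has_mat_framed _ fr).
  have hs' : has_slots Slot pj s by apply: (has_slots_framed _ fr).
  have ec' : ival s New 0 = c by rewrite (fr_i fr).
  have bS : (b < S)%N := lt_row p.
  have es : ival s Slot b = code (pj p) := hs' p.
  have ee : ival s Emit b = code (em' p) := he' p.
  have emE : em' p = pj p \/ exists2 j, pj p = Some j & em' p <> Some j.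
    case ep: (em' p) => [i|].
      have [j -> _] := fl_sinks hfl' ep.
      by have [->|ij] := eqVneq i j; [left|right; exists j => // -[/eqP]; rewrite (negPf ij)].
    by case: (pj p) => [j|]; [right; exists j|left].
  have [same|[j sj ne]] := emE.
    apply: wp_le; [apply: wp_ifT|].
    + by rewrite /= sb S_gt0 bS.
    + by rewrite /= sb es ee same leqnn.
    + apply: wp_skip; exists em', L'; split=> //.
        by apply: (flushing_skip (p := p) hfl').
      by apply: leq_trans hN' _; rewrite leq_add2l big_ord_recr leq_addr.
    by apply: leq_trans (leq_addl _ _).
  have occ : occupied st b = 1%N by rewrite /occupied (hs p) sj.
  have hN2 : (size L' < n * minn m n)%N.
    apply: leq_trans hN; apply: leq_ltn_trans hN' _; rewrite ltn_add2l.
    rewrite -!(big_mkord xpredT (occupied st)) (big_cat_nat (leq0n b) (ltnW bm)) /=.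
    by rewrite -[X in (X < _)%N]addn0 ltn_add2l big_ltn // occ.
  apply: wp_le; [apply: wp_ifF|].
  + by rewrite /= sb S_gt0 bS.
  + rewrite /= sb es ee sj; apply/negP => /andP[le1 le2].
    have : code (em' p) = j.+1 by apply/eqP; rewrite eqn_leq le2.
    by case: (em' p) ne => //= i ne [/val_inj e]; case: ne; rewrite e.
  + have esj : ival s Slot p = j.+1 by rewrite (hs' p) sj.
    apply: wp_use (wp_emit hf' hM' he' esj (p := p) sb ec' eL' eo' hN2) _.
    move=> s' fr' [he2 eL2 eo2].
    exists (set_slot em' p j), (rcons L' (col j M, (xl c, yl j))); split=> //.
    + exact: (flushing_emit (p := p)).
    + by rewrite size_rcons.
    by rewrite size_rcons big_ord_recr /= occ addnA addn1 ltnS.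
  by rewrite /= occ; lia.
apply: leq_add => //; apply: leq_sum => k _.
by rewrite /step_cost !mulnDl; lia.
Qed.

Record represented D M pj em L s : Prop := Represented {
  re_frame : has_frame s;
  re_mat : has_mat M s;
  re_slots : has_slots Slot pj s;
  re_emit : has_slots Emit em s;
  re_done : has_done D s;
  re_out : output m s = L;
  re_off : ival s OutOff 0 = (size L * m)%N }.

Definition after_steps (k : nat) s : Prop := exists D M pj em L,
  [/\ represented D M pj em L s, sweeping A lab M D pj em L,
      (size L <= k * minn m n)%N & #|D| = k].

Lemma output_framed c st s : Count \notin iwr c -> 1%N \notin fwr c ->
  2%N \notin lwr c -> 3%N \notin lwr c -> framed c st s -> output m s = output m st.
Proof.
move=> h1 h2 h3 h4 fr; rewrite /output (fr_i fr h1); apply: eq_mkseq => l.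
rewrite (fr_l fr h3) (fr_l fr h4); congr pair.
by apply/colP => i; rewrite !mxE (fr_f fr h2).
Qed.

(** There are at most [minn m n] held pivots. *)
Lemma sum_step_cost M D pj st : has_slots Slot pj st -> reducing A lab M D pj None ->
  (\sum_(k < m) step_cost (occupied st k) <= (m * 40 + 150) * minn m n + m * 60)%N.
Proof.
move=> hs hr; rewrite big_split /= -big_distrr /= sum_nat_const card_ord leq_add2r.
by rewrite leq_mul2l (sum_occupied hs hr) orbT.
Qed.

Definition sweep_cost : nat :=
  n * 100 + m * 120 + (m * 40 + 150) * minn m n * 2 + 300.

Lemma wp_sweep_step k st : (k < n)%N -> after_steps k st ->
  wp S sweep_step st sweep_cost (after_steps k.+1).
Proof.
move=> kn [D [M [pj [em [L [[hf hM hs he hd eL eo] hsw sL cD]]]]]].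
have hr := sw_red hsw; have cost := sum_step_cost hs hr.
apply: wp_le; [apply: wp_seq|].
  apply: wp_use (wp_find_best hf hd) _ => s1 fr1 fo.
  have [b [eb bD bmin]] : exists b : 'I_n, [/\ ival s1 Best 0 = b, b \notin D
      & forall j, j \notin D -> xl b <= xl j].
    case: fo => [[_ all]|//]; have := cD.
    rewrite (_ : D = [set: 'I_n]); last by apply/setP => j; rewrite all inE.
    by rewrite cardsT card_ord => e; rewrite e ltnn in kn.
  have {}hf : has_frame s1 by apply: (has_frame_framed _ fr1).
  have {}hM : has_mat M s1 by apply: (has_mat_framed _ fr1).
  have {}hs' : has_slots Slot pj s1 by apply: (has_slots_framed _ fr1).
  have {}he : has_slots Emit em s1 by apply: (has_slots_framed _ fr1).
  have {}hd : has_done D s1 by apply: (has_done_framed _ fr1).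
  have {}eL : output m s1 = L by rewrite -eL; apply: (output_framed _ _ _ _ fr1).
  have {}eo : ival s1 OutOff 0 = (size L * m)%N by rewrite (fr_i fr1).
  apply: wp_seq; apply: wp_iset; rewrite /= ?S_gt0 //.
  set s2 := Store _ _ _.
  have fr2 : framed (set_var New (var Best)) s1 s2.
    by split=> //= x; rewrite inE /upd => /negPf ->.
  apply: wp_seq.
  have {}hf2 : has_frame s2 by apply: (has_frame_framed _ fr2).
  have hM2 : has_mat M s2 by apply: (has_mat_framed _ fr2).
  have hs2 : has_slots Slot pj s2 by apply: (has_slots_framed _ fr2).
  have eb2 : ival s2 New 0 = b by rewrite /s2 /= /upd /= eb.
  apply: wp_use (wp_le (T' := (m * 40 + 150) * minn m n + m * 60 + 100)
    (wp_insert hf2 hM2 hs2 eb2 bD hr) _) _.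
    by rewrite leq_add2r; apply: sum_step_cost hs2 hr.
  move=> s3 fr3 [M' [pj' [hM3 hs3 hr3 hk3]]].
  have ec3 : ival s3 New 0 = b by rewrite (fr_i fr3).
  apply: wp_seq; apply: wp_iset; rewrite /= ?S_gt0 ?ec3 ?lt_col //.
  set s4 := Store _ _ _.
  have fr4 : framed (ISet Done (var New) (ICst 1)) s3 s4.
    by split=> //= x; rewrite inE /upd => /negPf ->.
  have hf4 : has_frame s4.
    by apply: (has_frame_framed _ fr4) => //; apply: (has_frame_framed _ fr3).
  have hd4 : has_done (b |: D) s4.
    move=> j; rewrite /s4 /= /upd /= !inE -val_eqE; case: eqP => //= _.
    by rewrite (fr_i fr3) // (fr_i fr2) // hd.
  apply: wp_seq; apply: wp_use (wp_find_best hf4 hd4) _ => s5 fr5 fo5.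
  have hf5 : has_frame s5 by apply: (has_frame_framed _ fr5).
  have hM5 : has_mat M' s5 by apply: (has_mat_framed _ fr5) => //; apply: (has_mat_framed _ fr4).
  have hs5 : has_slots Slot pj' s5.
    by apply: (has_slots_framed _ fr5) => //; apply: (has_slots_framed _ fr4).
  have he5 : has_slots Emit em s5.
    apply: (has_slots_framed _ fr5) => //; apply: (has_slots_framed _ fr4) => //.
    by apply: (has_slots_framed _ fr3) => //; apply: (has_slots_framed _ fr2).
  have hd5 : has_done (b |: D) s5 by apply: (has_done_framed _ fr5).
  have eL5 : output m s5 = L.
    rewrite -eL (output_framed _ _ _ _ fr5) // (output_framed _ _ _ _ fr4) //.
    by rewrite (output_framed _ _ _ _ fr3) // (output_framed _ _ _ _ fr2).
  have eo5 : ival s5 OutOff 0 = (size L * m)%N.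
    by rewrite (fr_i fr5) // (fr_i fr4) // (fr_i fr3) // (fr_i fr2).
  have ec5 : ival s5 New 0 = b by rewrite (fr_i fr5) // (fr_i fr4).
  have hfl := flushing_start hsw bD bmin hr3 hk3.
  have cD5 : #|b |: D| = k.+1 by rewrite cardsU1 bD cD.
  have best_lt : (ival s5 Best 0 < S)%N by case: fo5 => [[-> _]|[j [-> _ _]]].
  apply: wp_if.
  - by rewrite /= S_gt0 ec5 best_lt lt_col.
  - rewrite /= ec5 (hf_cols hf5) => cond; apply: wp_skip.
    exists (b |: D), M', pj', em, L; split=> //.
      case: fo5 cond => [[-> _]|[j [-> jD _]]]; first by rewrite addn1 ltnn.
      rewrite !(hf_x hf5) => /andP[_ le].
      exact: sweeping_same_x hfl (sw_before hsw) jD le.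
    by apply: leq_trans sL _; rewrite leq_mul2r leqnSn orbT.
  rewrite /= ec5 (hf_cols hf5) => cond.
  have occ5 := sum_occupied hs5 hr3.
  have room : (size L + \sum_(i < m) occupied s5 i <= n * minn m n)%N.
    apply: leq_trans (leq_add sL occ5) _.
    by rewrite addnC -mulSn leq_mul2r kn orbT.
  apply: wp_use (wp_le (T' := (m * 40 + 150) * minn m n + m * 60 + 20)
    (wp_flush hf5 hM5 hs5 he5 ec5 eL5 eo5 hfl room) _) _.
    by rewrite leq_add2r; apply: sum_step_cost hs5 hr3.
  move=> s6 fr6 [em' [L' [hfl' he6 eL6 eo6 sL6]]].
  exists (b |: D), M', pj', em', L'; split=> //.
  - split=> //.
    + exact: (has_frame_framed _ fr6).
    + exact: (has_mat_framed _ fr6).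
    + exact: (has_slots_framed _ fr6).
    + exact: (has_done_framed _ fr6).
  - apply: flushing_end hfl' _ => j jD.
    case: fo5 cond => [[_ all]|[j' [-> j'D j'min]]]; first by rewrite all in jD.
    rewrite addn1 ltn_ord /= !(hf_x hf5) -ltNge => lt.
    exact: lt_le_trans lt (j'min j jD).
  apply: leq_trans sL6 _; apply: leq_trans (leq_add sL occ5) _.
  by rewrite addnC -mulSn.
by rewrite /sweep_cost /=; lia.
Qed.

Lemma wp_init st : holds_input A lab st ->
  wp S init st (m * 40 + n * 50 + 60)%N (after_steps 0).
Proof.
move=> [em en eA elab].
apply: wp_le; [apply: wp_seq|].
  pose I b s := (forall p : 'I_m, (p < b)%N -> ival s Slot p = 0%N) /\
    (forall p : 'I_m, (p < b)%N -> ival s Emit p = 0%N).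
  apply: wp_use (@wp_for_const K S I Cnt Rows _ m 15 _ S_gt0 _ _ _ em _ _) _ => //.
    move=> b s bm fr sb [Is Ie]; have bS : (b < S)%N := lt_row (Ordinal bm).
    apply: wp_le; [apply: wp_seq; apply: wp_iset; rewrite /= ?sb ?S_gt0 //|].
      apply: wp_iset; rewrite /= /upd /= ?sb ?S_gt0 //.
      split=> p; rewrite /= /upd /= ltnS leq_eqVlt; case: eqP => //= _; [exact: Is|exact: Ie].
    by [].
  move=> s1 fr1 [Is Ie].
  apply: wp_seq; apply: wp_iset; rewrite /= ?S_gt0 //.
  apply: wp_seq; apply: wp_iset; rewrite /= ?S_gt0 //.
  apply: wp_seq; apply: wp_iset; rewrite /= ?S_gt0 //.
  pose J b s := [/\ forall j : 'I_n, (j < b)%N -> ival s Off j = (j * m)%N,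
    forall j : 'I_n, (j < b)%N -> ival s Done j = 0%N & ival s Tmp 0 = (b * m)%N].
  apply: wp_use (@wp_for_const K S J Cnt Cols _ n 30 _ S_gt0 _ _ _ _ _ _) _ => //.
  - by rewrite /= /upd /= (fr_i fr1).
  - move=> b s bn fr sb [Jo Jd Jt]; have bS : (b < S)%N := lt_col (Ordinal bn).
    have e0 : ival s Rows 0 = m by rewrite (fr_i fr) //= /upd /= (fr_i fr1).
    apply: wp_le; [apply: wp_seq; apply: wp_iset; rewrite /= ?sb ?S_gt0 //|].
      apply: wp_seq; apply: wp_iset; rewrite /= /upd /= ?sb ?S_gt0 //.
      apply: wp_iset; rewrite /= /upd /= ?S_gt0 //.
      split=> [j|j|]; rewrite /= /upd /=.
      + by rewrite ltnS leq_eqVlt; case: eqP => [->|_] //= /Jo.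
      + by rewrite ltnS leq_eqVlt; case: eqP => [->|_] //= /Jd.
      by rewrite Jt e0 mulSn addnC.
    by [].
  move=> s fr [Jo Jd _].
  exists set0, A, (fun=> None), (fun=> None), [::]; split=> //; last by rewrite cards0.
    split=> //.
    + split=> [||j|j|j].
      * by rewrite (fr_i fr) //= /upd /= (fr_i fr1).
      * by rewrite (fr_i fr) //= /upd /= (fr_i fr1).
      * exact: Jo.
      * by rewrite (fr_l fr) //= (fr_l fr1) // (elab j).1.
      * by rewrite (fr_l fr) //= (fr_l fr1) // (elab j).2.
    + by move=> i j; rewrite (fr_f fr) //= (fr_f fr1).
    + by move=> p; rewrite (fr_i fr) //= /upd /= Is.
    + by move=> p; rewrite (fr_i fr) //= /upd /= Ie.
    + by move=> j; rewrite Jd // inE.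
    + by rewrite /output (fr_i fr).
    by rewrite (fr_i fr).
  exact: sweeping_start.
by rewrite /=; lia.
Qed.

Lemma wp_groebner_program st : holds_input A lab st ->
  wp S groebner_program st (m * 40 + n * 50 + n * (sweep_cost + 15) + 100)%N
    (after_steps n).
Proof.
move=> hin; apply: wp_le; [apply: wp_seq; apply: wp_use (wp_init hin) _|].
  move=> s1 fr1 h0.
  apply: wp_use (@wp_for_const K S after_steps Iter Cols _ n sweep_cost _ S_gt0 _ _ _ _ _ _) _ => //.
  - by have [D [M [pj [em [L [[hf _ _ _ _ _ _] _ _ _]]]]]] := h0; apply: hf_cols hf.
  - have [D [M [pj [em [L [[hf hM hs he hd eL eo] hsw sL cD]]]]]] := h0.
    exists D, M, pj, em, L; split=> //; split=> //.
    by case: hf => *; split.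
  - move=> k s kn fr sk hk; apply: wp_use (wp_sweep_step kn hk) _ => s' _.
    move=> [D [M [pj [em [L [[hf hM hs he hd eL eo] hsw sL cD]]]]]].
    exists D, M, pj, em, L; split=> //; split=> //.
    by case: hf => *; split.
by rewrite /=; lia.
Qed.

End Correctness.

Lemma resource_bounds (m n : nat) : (0 < m)%N -> (0 < n)%N ->
  (m * 40 + n * 50 + n * (sweep_cost m n + 15) + 100 <=
     1000 * (m * n * minn m n + n ^ 2))%N /\
  (m * n * minn m n + m * n + m + n + 2 <= 1000 * (m * n * minn m n))%N.
Proof.
move=> m0 n0; have min0 : (0 < minn m n)%N by rewrite leq_min m0.
rewrite /sweep_cost; set r := minn m n in min0 *.
have mn : (m * n <= m * n * r)%N by rewrite leq_pmulr.
have nr : (n * r <= m * n * r)%N by rewrite leq_mul2r leq_pmull // orbT.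
have le_m : (m <= m * n)%N by rewrite leq_pmulr.
have le_n : (n <= m * n)%N by rewrite leq_pmull.
have nn : (n <= n ^ 2)%N by rewrite -mulnn leq_pmulr.
have -> : (n * (n * 100 + m * 120 + (m * 40 + 150) * r * 2 + 300 + 15) =
    100 * n ^ 2 + 120 * (m * n) + 80 * (m * n * r) + 300 * (n * r) + 315 * n)%N.
  by rewrite -mulnn; nia.
by split; lia.
Qed.

(** * The theorem *)

Theorem mainTheorem3 (K : fieldType) :
  exists (P : cmd) (C : nat),
  forall (m n : nat) (A : 'M[K]_(m, n)) (lab : 'I_n -> grade),
    colex_sorted lab ->
  forall (F F' : bipersMod K) (B : 'I_n -> F)
         (B' : 'I_m -> F') (gr' : 'I_m -> grade) (gamma : {linear F -> F'}),
    is_free F -> is_free F' ->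
    ordered_basis B lab -> ordered_basis B' gr' ->
    graded gamma -> represents A gamma B lab B' gr' ->
  forall st : store K, holds_input A lab st ->
  exists (st' : store K) (t S : nat),
    [/\ exec S P st st' t,
        lists_min_groebner B' gr' (im_of gamma) (output m st')
      & (0 < m)%N -> (0 < n)%N ->
        (t <= C * (m * n * minn m n + n ^ 2))%N /\
        (S <= C * (m * n * minn m n))%N].
Proof.
exists groebner_program, 1000%N.
move=> m n A lab _ F F' B B' gr' gamma _ freeF' basisB basisB' hg hrep st hin.
pose S := (m * n * minn m n + m * n + m + n + 2)%N.
have [||||||st' [t [ex le [D [M [pj [em [L [[_ _ _ _ _ eL _] hsw _ cD]]]]]]]]] :=
  @wp_groebner_program K m n A lab S _ _ _ _ _ _ st hin; rewrite ?/S; try lia.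
- apply: (@leq_trans (n * m)%N); last by lia.
  by rewrite leq_mul2l geq_minl orbT.
exists st', t, S; split=> // [|m0 n0]; last first.
  have [bT bS] := resource_bounds m0 n0.
  by split; [apply: leq_trans le bT|apply: bS].
have DT j : j \in D.
  suff -> : D = [set: 'I_n] by rewrite inE.
  by apply/eqP; rewrite eqEcard subsetT cardsT card_ord cD leqnn.
have hl := sw_log hsw; rewrite eL.
apply: (min_groebner_criterion freeF' basisB basisB' hg hrep).
- exact: log_uniq hl.
- exact: log_im hl.
- by move=> z w p wz pw; apply: (sw_complete hsw) wz pw.
exact: log_anti hl.
Qed.
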